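(* The following is provable in $\mathbf{ZF}$: the Principle of Dependent Choices $\mathbf{DC}$ implies that, for every normal generalized topological space $\mathbf{X}$, $\mathbf{GUL(X)}$ holds.
   Context: $\mathbf{DC}$: for every non-empty set $A$ and every binary relation $S$ on $A$, if $(\forall x\in A)(\exists y\in A)\,\langle x,y\rangle\in S$, then there is $a\in A^{\omega}$ such that $\langle a(n),a(n+1)\rangle\in S$ for all $n\in\omega$. A generalized topology in a set $X$ is a collection $\mu$ of subsets of $X$ closed under arbitrary unions (so $\emptyset\in\mu$, but $X\in\mu$ is not required, nor is closure under finite intersections). A generalized topological space is a pair $\mathbf{X}=\langle X,\mu\rangle$ with $\mu$ a generalized topology in $X$. A set $A\subseteq X$ is $\mu$-open if $A\in\mu$ and $\mu$-closed if $X\setminus A\in\mu$. $\mathbf{X}$ is normal if for every pair $A,B$ of disjoint $\mu$-closed sets there are disjoint $\mu$-open sets $U,V$ with $A\subseteq U$ and $B\subseteq V$. For generalized topological spaces $\langle X,\mu_X\rangle$, $\langle Y,\mu_Y\rangle$, a map $f:X\to Y$ is $\langle\mu_X,\mu_Y\rangle$-continuous if $f^{-1}[V]\in\mu_X$ for every $V\in\mu_Y$. $g\tau_n=\{\emptyset,\mathbb{R}\}\cup\{(-\infty,a):a\in\mathbb{R}\}\cup\{(a,+\infty):a\in\mathbb{R}\}\cup\{(-\infty,a)\cup(b,+\infty): a,b\in\mathbb{R},\ a\leq b\}$, a generalized topology in $\mathbb{R}$. $\mathbf{GUL(X)}$ is the statement: for every pair $A,B$ of disjoint $\mu$-closed sets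 there exists a $\langle\mu,g\tau_n\rangle$-continuous $f:X\to\mathbb{R}$ with $A\subseteq f^{-1}[\{0\}]$ and $B\subseteq f^{-1}[\{1\}]$. *)

(* Defs.v *)
From Stdlib Require Import List PeanoNat.
Import ListNotations.

(** Provability in ZF is a statement about the formal theory ZF, so it is
    expressed with an explicit syntax and deduction system: Rocq functions,
    predicates and choice principles play no role inside the theory.
    Variables are de Bruijn indices and are the only terms. *)

Inductive form : Type :=
| fBot : form
| fEq  : nat -> nat -> form
| fMem : nat -> nat -> form
| fImp : form -> form -> form
| fAll : form -> form.

Definition up (r : nat -> nat) (k : nat) : nat :=
  match k with 0 => 0 | S k' => S (r k') end.

Fixpoint ren (r : nat -> nat) (p : form) : form :=
  match p with
  | fBot => fBot
  | fEq x y => fEq (r x) (r y)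
  | fMem x y => fMem (r x) (r y)
  | fImp p q => fImp (ren r p) (ren r q)
  | fAll p => fAll (ren (up r) p)
  end.

Definition shift : form -> form := ren S.

Definition subst0 (t : nat) : form -> form :=
  ren (fun k => match k with 0 => t | S k' => k' end).

Fixpoint bounded (n : nat) (p : form) : Prop :=
  match p with
  | fBot => True
  | fEq x y | fMem x y => x < n /\ y < n
  | fImp p q => bounded n p /\ bounded n q
  | fAll p => bounded (S n) p
  end.

Definition closed (p : form) : Prop := bounded 0 p.

Fixpoint fAlls (n : nat) (p : form) : form :=
  match n with 0 => p | S n' => fAll (fAlls n' p) end.

Inductive nd : list form -> form -> Prop :=
| nd_hyp  G p : In p G -> nd G p
| nd_impI G p q : nd (p :: G) q -> nd G (fImp p q)
| nd_impE G p q : nd G (fImp p q) -> nd G p -> nd G q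
| nd_raa  G p : nd (fImp p fBot :: G) fBot -> nd G p
| nd_allI G p : nd (map shift G) p -> nd G (fAll p)
| nd_allE G p t : nd G (fAll p) -> nd G (subst0 t p)
| nd_eqI  G x : nd G (fEq x x)
| nd_eqE  G p x y : nd G (fEq x y) -> nd G (subst0 x p) -> nd G (subst0 y p).

Definition provable (T : form -> Prop) (p : form) : Prop :=
  exists G : list form, (forall q, In q G -> T q) /\ nd G p.

(** A [pre] is a formula awaiting the number [d] of quantifiers above it.
    Bound variables are de Bruijn levels: level [l] under [d] quantifiers is
    the index [d - S l].  Thus [∀ x, P x] can be written with a Rocq binder,
    and [P 0] is the actual formula. *)

Definition pre : Type := nat -> form.
Definition var : Type := nat.

Definition pbot : pre := fun _ => fBot.
Definition peq (x y : var) : pre := fun d => fEq (d - S x) (d - S y).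
Definition pmem (x y : var) : pre := fun d => fMem (d - S x) (d - S y).
Definition pimp (P Q : pre) : pre := fun d => fImp (P d) (Q d).
Definition pall (P : var -> pre) : pre := fun d => fAll (P d (S d)).

Definition pnot (P : pre) : pre := pimp P pbot.
Definition por (P Q : pre) : pre := pimp (pnot P) Q.
Definition pand (P Q : pre) : pre := pnot (pimp P (pnot Q)).
Definition piff (P Q : pre) : pre := pand (pimp P Q) (pimp Q P).
Definition pex (P : var -> pre) : pre := pnot (pall (fun x => pnot (P x))).

(** [p(x)] and [p(x,y)] for a formula [p] whose first free indices (0, resp.
    0 and 1) are its arguments; the remaining free indices are parameters,
    left free in the whole [pre]. *)
Definition app1 (p : form) (x : var) : pre :=
  fun d => ren (fun k => match k with 0 => d - S x | S k' => d + k' end) p.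
Definition app2 (p : form) (x y : var) : pre :=
  fun d => ren (fun k => match k with
                         | 0 => d - S x
                         | 1 => d - S y
                         | S (S k') => d + k'
                         end) p.

Declare Scope fol_scope.
Delimit Scope fol_scope with fol.
Bind Scope fol_scope with pre.

Notation "x ∈ y" := (pmem x y) (at level 70) : fol_scope.
Notation "x ≐ y" := (peq x y) (at level 70) : fol_scope.
Notation "¬ P" := (pnot P) (at level 75, right associativity) : fol_scope.
Notation "P ∧ Q" := (pand P Q) (at level 80, right associativity) : fol_scope.
Notation "P ∨ Q" := (por P Q) (at level 85, right associativity) : fol_scope.
Notation "P ⇒ Q" := (pimp P Q) (at level 90, right associativity) : fol_scope.
Notation "P ⇔ Q" := (piff P Q) (at level 95, no associativity) : fol_scope.
Notation "∀ x .. y , P" := (pall (fun x => .. (pall (fun y => P%fol)) ..))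
  (at level 200, x binder, y binder, right associativity) : fol_scope.
Notation "∃ x .. y , P" := (pex (fun x => .. (pex (fun y => P%fol)) ..))
  (at level 200, x binder, y binder, right associativity) : fol_scope.

Definition all_in (A : var) (P : var -> pre) : pre :=
  pall (fun x => pimp (pmem x A) (P x)).
Definition ex_in (A : var) (P : var -> pre) : pre :=
  pex (fun x => pand (pmem x A) (P x)).

Notation "∀[ A ] x .. y , P" :=
  (all_in A (fun x => .. (all_in A (fun y => P%fol)) ..))
  (at level 200, A at level 69, x binder, y binder, right associativity)
  : fol_scope.
Notation "∃[ A ] x .. y , P" :=
  (ex_in A (fun x => .. (ex_in A (fun y => P%fol)) ..))
  (at level 200, A at level 69, x binder, y binder, right associativity)
  : fol_scope.

Local Open Scope fol_scope.

Definition subset (x y : var) : pre := ∀[x] z, z ∈ y.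
Definition is_empty (x : var) : pre := ∀ z, ¬ z ∈ x.
Definition nonempty (x : var) : pre := ∃ z, z ∈ x.
Definition disjoint (x y : var) : pre := ¬ ∃ z, z ∈ x ∧ z ∈ y.
Definition is_union (u F : var) : pre := ∀ x, x ∈ u ⇔ ∃[F] y, x ∈ y.
Definition is_diff (d x y : var) : pre := ∀ z, z ∈ d ⇔ z ∈ x ∧ ¬ z ∈ y.

Definition is_upair (p x y : var) : pre := ∀ z, z ∈ p ⇔ z ≐ x ∨ z ≐ y.

(** Kuratowski pair: p = {{x},{x,y}}. *)
Definition is_opair (p x y : var) : pre :=
  ∃ u v, is_upair u x x ∧ is_upair v x y ∧ is_upair p u v.

(** ⟨x,y⟩ ∈ S; for a function S this reads S(x) = y. *)
Definition holds (S x y : var) : pre := ∃[S] p, is_opair p x y.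

Definition is_prod (P A B : var) : pre :=
  ∀ p, p ∈ P ⇔ ∃[A] x, ∃[B] y, is_opair p x y.

Definition is_rel (S A B : var) : pre :=
  ∀[S] p, ∃[A] x, ∃[B] y, is_opair p x y.

Definition is_fun (f A B : var) : pre :=
  is_rel f A B ∧
  ∀[A] x, ∃ y, holds f x y ∧ ∀ y', holds f x y' ⇒ y' ≐ y.

Definition is_succ (s x : var) : pre := ∀ z, z ∈ s ⇔ z ∈ x ∨ z ≐ x.

Definition inductive_set (w : var) : pre :=
  (∃[w] e, is_empty e) ∧ ∀[w] x, ∃[w] s, is_succ s x.

Definition is_omega (w : var) : pre :=
  inductive_set w ∧ ∀ v, inductive_set v ⇒ subset w v.

Definition ax_extensionality : pre :=
  ∀ x y, (∀ z, z ∈ x ⇔ z ∈ y) ⇒ x ≐ y.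
Definition ax_foundation : pre :=
  ∀ x, nonempty x ⇒ ∃[x] y, disjoint y x.
Definition ax_pairing : pre := ∀ x y, ∃ p, is_upair p x y.
Definition ax_union : pre := ∀ F, ∃ u, is_union u F.
Definition ax_powerset : pre := ∀ x, ∃ P, ∀ y, y ∈ P ⇔ subset y x.
Definition ax_infinity : pre := ∃ w, inductive_set w.
Definition ax_separation (p : form) : pre :=
  ∀ a, ∃ b, ∀ z, z ∈ b ⇔ z ∈ a ∧ app1 p z.
Definition ax_replacement (p : form) : pre :=
  (∀ x y y', app2 p x y ⇒ app2 p x y' ⇒ y ≐ y') ⇒
  ∀ a, ∃ b, ∀ y, y ∈ b ⇔ ∃[a] x, app2 p x y.

Inductive ZF : form -> Prop :=
| ZF_extensionality : ZF (ax_extensionality 0)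
| ZF_foundation : ZF (ax_foundation 0)
| ZF_pairing : ZF (ax_pairing 0)
| ZF_union : ZF (ax_union 0)
| ZF_powerset : ZF (ax_powerset 0)
| ZF_infinity : ZF (ax_infinity 0)
| ZF_separation n p :
    closed (fAlls n (ax_separation p 0)) -> ZF (fAlls n (ax_separation p 0))
| ZF_replacement n p :
    closed (fAlls n (ax_replacement p 0)) -> ZF (fAlls n (ax_replacement p 0)).

Definition DC : pre :=
  ∀ A S,
    nonempty A ⇒ is_rel S A A ⇒
    (∀[A] x, ∃[A] y, holds S x y) ⇒
    ∀ w, is_omega w ⇒
    ∃ a, is_fun a w A ∧
      ∀[w] n m, is_succ m n ⇒
        ∀[A] x y, holds a n x ⇒ holds a m y ⇒ holds S x y.

Definition gen_topology (X mu : var) : pre :=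
  (∀[mu] U, subset U X) ∧
  ∀ F, subset F mu ⇒ ∀ U, is_union U F ⇒ U ∈ mu.

Definition closed_in (X mu A : var) : pre :=
  subset A X ∧ ∀ C, is_diff C X A ⇒ C ∈ mu.

Definition normal (X mu : var) : pre :=
  ∀ A B, closed_in X mu A ⇒ closed_in X mu B ⇒ disjoint A B ⇒
    ∃[mu] U V, disjoint U V ∧ subset A U ∧ subset B V.

Definition is_preimage (P f X V : var) : pre :=
  ∀ x, x ∈ P ⇔ x ∈ X ∧ ∃[V] y, holds f x y.

Definition continuous (f X mu nu : var) : pre :=
  ∀[nu] V, ∀ P, is_preimage P f X V ⇒ P ∈ mu.

(** The reals are any complete ordered field: ZF proves that there is one and
    that it is unique up to isomorphism.  Operations are sets of pairs
    ⟨⟨x,y⟩,z⟩. *)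

Definition is_binop (op R : var) : pre :=
  ∀ P, is_prod P R R ⇒ is_fun op P R.

Definition op_eq (op x y z : var) : pre :=
  ∃ p, is_opair p x y ∧ holds op p z.

Definition op_comm (op R : var) : pre :=
  ∀[R] x y z, op_eq op x y z ⇒ op_eq op y x z.

Definition op_assoc (op R : var) : pre :=
  ∀[R] x y z u v w,
    op_eq op x y u ⇒ op_eq op u z w ⇒ op_eq op y z v ⇒ op_eq op x v w.

Definition op_unit (op R e : var) : pre := ∀[R] x, op_eq op x e x.

Definition is_field (R add mul zero one : var) : pre :=
  zero ∈ R ∧ one ∈ R ∧ ¬ zero ≐ one ∧
  is_binop add R ∧ op_comm add R ∧ op_assoc add R ∧ op_unit add R zero ∧
  (∀[R] x, ∃[R] y, op_eq add x y zero) ∧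
  is_binop mul R ∧ op_comm mul R ∧ op_assoc mul R ∧ op_unit mul R one ∧
  (∀[R] x, ¬ x ≐ zero ⇒ ∃[R] y, op_eq mul x y one) ∧
  (∀[R] x y z s t u v,
     op_eq add y z s ⇒ op_eq mul x s t ⇒
     op_eq mul x y u ⇒ op_eq mul x z v ⇒ op_eq add u v t).

Definition strict_linear_order (R lt : var) : pre :=
  is_rel lt R R ∧
  (∀[R] x, ¬ holds lt x x) ∧
  (∀[R] x y z, holds lt x y ⇒ holds lt y z ⇒ holds lt x z) ∧
  (∀[R] x y, holds lt x y ∨ x ≐ y ∨ holds lt y x).

Definition le (lt x y : var) : pre := holds lt x y ∨ x ≐ y.

Definition upper_bound (lt E u : var) : pre := ∀[E] x, le lt x u.

Definition order_complete (R lt : var) : pre :=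
  ∀ E, subset E R ⇒ nonempty E ⇒ (∃[R] u, upper_bound lt E u) ⇒
    ∃[R] s, upper_bound lt E s ∧
      ∀[R] u, upper_bound lt E u ⇒ le lt s u.

Definition is_real_field (R add mul lt zero one : var) : pre :=
  is_field R add mul zero one ∧
  strict_linear_order R lt ∧
  (∀[R] x y z s t,
     holds lt x y ⇒ op_eq add x z s ⇒ op_eq add y z t ⇒ holds lt s t) ∧
  (∀[R] x y z,
     holds lt zero x ⇒ holds lt zero y ⇒ op_eq mul x y z ⇒ holds lt zero z) ∧
  order_complete R lt.

Definition is_left_ray (U R lt a : var) : pre :=
  ∀ x, x ∈ U ⇔ x ∈ R ∧ holds lt x a.
Definition is_right_ray (U R lt a : var) : pre :=
  ∀ x, x ∈ U ⇔ x ∈ R ∧ holds lt a x.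
Definition is_two_rays (U R lt a b : var) : pre :=
  ∀ x, x ∈ U ⇔ x ∈ R ∧ (holds lt x a ∨ holds lt b x).

(** nu = gτ_n, the generalized topology of the real line. *)
Definition is_gtau_n (nu R lt : var) : pre :=
  ∀ U, U ∈ nu ⇔
    is_empty U ∨ U ≐ R ∨
    (∃[R] a, is_left_ray U R lt a) ∨
    (∃[R] a, is_right_ray U R lt a) ∨
    (∃[R] a b, le lt a b ∧ is_two_rays U R lt a b).

Definition GUL (X mu : var) : pre :=
  ∀ R add mul lt zero one, is_real_field R add mul lt zero one ⇒
  ∀ nu, is_gtau_n nu R lt ⇒
  ∀ A B, closed_in X mu A ⇒ closed_in X mu B ⇒ disjoint A B ⇒
    ∃ f, is_fun f X R ∧ continuous f X mu nu ∧
      (∀[A] x, holds f x zero) ∧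
      (∀[B] x, holds f x one).

(* Main.v *)
From Stdlib Require Import List Arith Lia Cantor Eqdep_dec Classical ClassicalEpsilon
  FunctionalExtensionality PropExtensionality.
Require Import Defs.
Import ListNotations.

(** Provability in ZF is reached through Gödel's completeness theorem
    ([completeness]): a sentence true in every model of ZF is provable from ZF.
    The axioms are closed formulas, so the variables can serve as Henkin
    witnesses, and a quotient of the variables is a model.  It remains to prove
    the statement in an arbitrary model [M] of ZF.  There Separation is
    available only for predicates definable with parameters, and [Def] is a
    semantic notion of definability, closed under all connectives, under which
    [separation] becomes a statement about predicates on [M].  The model may
    have nonstandard natural numbers, so every induction and every supremum
    below is taken over a set of the model.

    Inside [M] the argument is Urysohn's.  Write U below V if a closed set lies
    between the open sets U and V.  Normality makes this relation interpolative
    ([Below_interpolate]) and gives U0 below U1 with A inside U0 and B disjoint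
    from U1.  A scale is a family of pairs (d,U), with d in [0,1] and U open,
    containing (0,U0) and (1,U1) and strictly increasing for this relation.
    Given a scale whose indices are dense, let f(x) be the supremum of 0 and of
    the d whose U misses x.  Then f is 0 on A and 1 on B.  If f(x) < a and
    a <= 1, a member of the scale with index between f(x) and a is a
    neighbourhood of x on which f < a.  If f(x) > b and b >= 0, the complement of
    a closed set between two members with indices between b and f(x) is one on
    which f > b.  For other a and b the whole space will do, which is open as
    the union of the complements of A and B.  Unions of such neighbourhoods are all that a generalized topology has to provide, because
    the open sets of the target are rays and unions of two rays
    ([value_function]).

    Dependent choice yields the dense scale ([dense_scale_exists]).  A state is
    a scale together with a step d and a position q in [0,1).  The next state
    inserts a member at q + d; when q + d reaches 1, it goes back to q = 0 and
    halves d.  Instead of being finite, the scale of a state is required to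
    have neighbours around every missing index ([Discrete]), which is all that
    an insertion uses and which an insertion preserves.  That the positions are dense
    ([sweep_dense]) follows from two consequences of completeness: a nonempty
    bounded set of reals is not closed under a positive shift, and one with a
    positive element is not closed under doubling.  Neither natural numbers nor
    dyadic rationals have to be embedded in the field.  The index set omega
    serves only for [dc_chain], which says that the states chosen are linearly
    ordered by inclusion of their scales, so that their union is a scale. *)

(** * Syntax *)

Lemma bounded_mono p : forall n m, n <= m -> bounded n p -> bounded m p.
Proof.
  induction p; cbn; intros a b Hab; try lia.
  - intros [H1 H2]; split; eauto.
  - apply IHp; lia.
Qed.

Fixpoint var_bound (p : form) : nat :=
  match p with
  | fBot => 0
  | fEq x y | fMem x y => S (x + y)
  | fImp p q => var_bound p + var_bound q
  | fAll p => var_bound p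
  end.

Lemma bounded_var_bound p : bounded (var_bound p) p.
Proof.
  induction p; cbn; try lia.
  - split; [apply (bounded_mono p1 (var_bound p1)) | apply (bounded_mono p2 (var_bound p2))];
      auto; lia.
  - apply (bounded_mono p (var_bound p)); auto.
Qed.

Lemma ren_ext_bounded p : forall n f g,
  bounded n p -> (forall k, k < n -> f k = g k) -> ren f p = ren g p.
Proof.
  induction p; cbn; intros m f g Hb E.
  - reflexivity.
  - rewrite !E by tauto; reflexivity.
  - rewrite !E by tauto; reflexivity.
  - f_equal; [apply (IHp1 m) | apply (IHp2 m)]; tauto.
  - f_equal; apply (IHp (S m)); auto.
    intros [|k] Hk; cbn; auto. rewrite E by lia; reflexivity.
Qed.

Lemma ren_ext p f g : (forall k, f k = g k) -> ren f p = ren g p.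
Proof. intros E; eapply ren_ext_bounded; [apply bounded_var_bound | auto]. Qed.

Lemma ren_comp p : forall f g, ren f (ren g p) = ren (fun k => f (g k)) p.
Proof.
  induction p; cbn; intros f g; f_equal; auto.
  rewrite IHp; apply ren_ext; intros [|k]; reflexivity.
Qed.

Lemma ren_id p f : (forall k, f k = k) -> ren f p = p.
Proof.
  revert f; induction p; cbn; intros f E; rewrite ?E; f_equal; auto.
  apply IHp; intros [|k]; cbn; auto.
Qed.

Lemma ren_shift p f : ren (up f) (shift p) = shift (ren f p).
Proof. unfold shift; rewrite !ren_comp; apply ren_ext; reflexivity. Qed.

Lemma ren_subst0 p t f : ren f (subst0 t p) = subst0 (f t) (ren (up f) p).
Proof. unfold subst0; rewrite !ren_comp; apply ren_ext; intros [|k]; reflexivity. Qed.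

(** * Structural rules of the deduction system *)

Lemma nd_weaken G p : nd G p -> forall G', incl G G' -> nd G' p.
Proof.
  induction 1; intros G' I.
  - apply nd_hyp; auto.
  - apply nd_impI, IHnd, incl_cons; [left; auto | apply incl_tl; auto].
  - eapply nd_impE; eauto.
  - apply nd_raa, IHnd, incl_cons; [left; auto | apply incl_tl; auto].
  - apply nd_allI, IHnd, incl_map; auto.
  - apply nd_allE; auto.
  - apply nd_eqI.
  - eapply nd_eqE; eauto.
Qed.

Lemma nd_ren G p : nd G p -> forall f, nd (map (ren f) G) (ren f p).
Proof.
  induction 1; intros f; cbn.
  - apply nd_hyp, in_map; auto.
  - apply nd_impI, (IHnd f).
  - eapply nd_impE; [apply (IHnd1 f) | apply (IHnd2 f)].
  - apply nd_raa, (IHnd f).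
  - apply nd_allI.
    replace (map shift (map (ren f) G)) with (map (ren (up f)) (map shift G)); auto.
    rewrite !map_map; apply map_ext; intros; apply ren_shift.
  - rewrite ren_subst0; apply nd_allE, (IHnd f).
  - apply nd_eqI.
  - rewrite ren_subst0; eapply nd_eqE; [apply (IHnd1 f)|].
    rewrite <- ren_subst0; apply (IHnd2 f).
Qed.

(** * Completeness of the deduction system *)

Definition scons {M : Type} (v : M) (r : nat -> M) (k : nat) : M :=
  match k with 0 => v | S k' => r k' end.

Fixpoint sat {M : Type} (mem : M -> M -> Prop) (r : nat -> M) (p : form) : Prop :=
  match p with
  | fBot => False
  | fEq x y => r x = r y
  | fMem x y => mem (r x) (r y)
  | fImp p q => sat mem r p -> sat mem r q
  | fAll p => forall v, sat mem (scons v r) p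
  end.

Lemma sat_ren {M} (mem : M -> M -> Prop) p : forall f r,
  sat mem r (ren f p) <-> sat mem (fun k => r (f k)) p.
Proof.
  induction p; cbn; intros f r; try tauto.
  - rewrite IHp1, IHp2; tauto.
  - assert (E : forall v, (fun k => scons v r (up f k)) = scons v (fun k => r (f k)))
      by (intros v; apply functional_extensionality; intros [|k]; reflexivity).
    split; intros H v; specialize (H v); [rewrite <- E, <- IHp | rewrite IHp, E]; exact H.
Qed.

Fixpoint decode (fuel n : nat) : form :=
  match fuel with
  | 0 => fBot
  | S fuel =>
      let (tag, m) := of_nat n in
      let (x, y) := of_nat m in
      match tag with
      | 0 => fEq x y
      | 1 => fMem x y
      | 2 => fImp (decode fuel x) (decode fuel y)
      | 3 => fAll (decode fuel m)
      | _ => fBot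
      end
  end.

Definition enum (n : nat) : form := let (fuel, m) := of_nat n in decode fuel m.

Lemma decode_surj p : exists k n, forall fuel, k <= fuel -> decode fuel n = p.
Proof.
  induction p as [|x y|x y|p [k [n Hp]] q [l [m Hq]]|p [k [n Hp]]].
  - exists 1, (to_nat (4, 0)); intros [|f] H; [lia|]; cbn [decode].
    rewrite cancel_of_to; reflexivity.
  - exists 1, (to_nat (0, to_nat (x, y))); intros [|f] H; [lia|]; cbn [decode].
    rewrite !cancel_of_to; reflexivity.
  - exists 1, (to_nat (1, to_nat (x, y))); intros [|f] H; [lia|]; cbn [decode].
    rewrite !cancel_of_to; reflexivity.
  - exists (S (k + l)), (to_nat (2, to_nat (n, m))); intros [|f] H; [lia|]; cbn [decode].
    rewrite !cancel_of_to, Hp, Hq by lia; reflexivity.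
  - exists (S k), (to_nat (3, n)); intros [|f] H; [lia|]; cbn [decode].
    rewrite !cancel_of_to; destruct (of_nat n); rewrite Hp by lia; reflexivity.
Qed.

Lemma enum_surj p : exists n, enum n = p.
Proof.
  destruct (decode_surj p) as [k [n H]]; exists (to_nat (k, n)).
  unfold enum; rewrite cancel_of_to; auto.
Qed.

Section Completeness.

Variable T : form -> Prop.
Hypothesis T_closed : forall p, T p -> closed p.

Definition proves (G : list form) (p : form) : Prop :=
  exists H, (forall q, In q H -> T q) /\ nd (H ++ G) p.

Lemma proves_weaken G G' p : incl G G' -> proves G p -> proves G' p.
Proof.
  intros I [H [HT D]]; exists H; split; auto.
  eapply nd_weaken; eauto. apply incl_app_app; [apply incl_refl | auto].
Qed.

Lemma proves_lift G p : nd G p -> proves G p.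
Proof. intros D; exists []; split; [intros q [] | exact D]. Qed.

Lemma proves_cut G p q : proves G p -> proves (p :: G) q -> proves G q.
Proof.
  intros [H [HT D]] [K [KT E]]; exists (H ++ K); split.
  - intros r Hr; apply in_app_or in Hr; destruct Hr; auto.
  - apply nd_impE with p.
    + apply nd_impI; eapply nd_weaken; [exact E|].
      intros r; cbn; rewrite !in_app_iff; cbn; tauto.
    + eapply nd_weaken; [exact D|]. intros r; rewrite !in_app_iff; tauto.
Qed.

Lemma proves_impI G p q : proves (p :: G) q -> proves G (fImp p q).
Proof.
  intros [H [HT D]]; exists H; split; auto.
  apply nd_impI; eapply nd_weaken; [exact D|].
  intros r; cbn; rewrite !in_app_iff; cbn; tauto.
Qed.

Lemma proves_hyp G p : In p G -> proves G p.
Proof. intros; apply proves_lift, nd_hyp; auto. Qed.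

Lemma proves_impE G p q : proves G (fImp p q) -> proves G p -> proves G q.
Proof.
  intros H1 H2; eapply proves_cut; [exact H1|].
  eapply proves_cut; [eapply proves_weaken; [|exact H2]; apply incl_tl, incl_refl|].
  apply proves_lift, nd_impE with p; apply nd_hyp; cbn; auto.
Qed.

Lemma proves_raa G p : proves (fImp p fBot :: G) fBot -> proves G p.
Proof.
  intros H; eapply proves_cut; [apply proves_impI; exact H|].
  apply proves_lift, nd_raa, nd_impE with (fImp p fBot); apply nd_hyp; cbn; auto.
Qed.

(** The axioms of [T] are closed, so a variable that does not occur in [G] is
    an eigenvariable for them as well: renaming it to index 0 and shifting all
    the others turns [p(y)] into [p]. *)
Lemma proves_allI_fresh G p y :
  (forall q, In q (fAll p :: G) -> bounded y q) ->
  proves G (subst0 y p) -> proves G (fAll p).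
Proof.
  intros Hy [H [HT D]]; exists H; split; auto.
  apply nd_allI.
  set (f := fun k => if k =? y then 0 else S k).
  assert (Ef : forall k, k < y -> f k = S k).
  { intros k Hk; unfold f; destruct (Nat.eqb_spec k y); [lia | auto]. }
  replace p with (ren f (subst0 y p)).
  - replace (map shift (H ++ G)) with (map (ren f) (H ++ G)); [apply nd_ren; auto|].
    apply map_ext_in; intros q Hq; apply in_app_or in Hq.
    apply (ren_ext_bounded q y); auto.
    destruct Hq as [Hq|Hq]; [|apply Hy; cbn; auto].
    apply bounded_mono with 0; [lia | apply (T_closed q); auto].
  - assert (Hp : bounded (S y) p) by (apply (Hy (fAll p)); cbn; auto).
    unfold subst0; rewrite ren_comp.
    rewrite (ren_ext_bounded p (S y) _ (fun k => k)); auto using ren_id.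
    intros [|k] Hk; [unfold f; rewrite Nat.eqb_refl; auto | apply Ef; lia].
Qed.

Definition consistent (G : list form) : Prop := ~ proves G fBot.

Lemma consistent_neg G p : ~ proves G p -> consistent (fImp p fBot :: G).
Proof. intros H C; apply H, proves_raa, C. Qed.

Definition fresh (G : list form) : nat := list_sum (map var_bound G).

Lemma fresh_spec G p : In p G -> bounded (fresh G) p.
Proof.
  intros H; apply bounded_mono with (var_bound p); [|apply bounded_var_bound].
  unfold fresh; induction G as [|q G IH]; cbn; destruct H; subst; [lia|].
  specialize (IH H); unfold list_sum in *; lia.
Qed.

(** A negated universal statement comes with a counterexample, named by a
    variable that is new at that stage. *)
Definition witness (G : list form) (p : form) : list form :=
  match p with
  | fImp (fAll q) fBot => [fImp (subst0 (fresh (p :: G)) q) fBot]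
  | _ => []
  end.

Definition extend (G : list form) (p : form) : list form :=
  if excluded_middle_informative (consistent (p :: G))
  then witness G p ++ p :: G else G.

Lemma witness_consistent G p :
  consistent (p :: G) -> consistent (witness G p ++ p :: G).
Proof.
  intros C; destruct p as [| | |[| | | |q] [| | | |]|]; try exact C.
  cbn [witness app]; set (p := fImp (fAll q) fBot) in *.
  apply consistent_neg; intros H; apply C.
  apply proves_impE with (fAll q); [apply proves_hyp; left; reflexivity|].
  apply proves_allI_fresh with (fresh (p :: G)); auto.
  intros r [<-|Hr]; [|apply fresh_spec; auto].
  apply (fresh_spec (p :: G) p); left; auto.
Qed.

Lemma extend_consistent G p : consistent G -> consistent (extend G p).
Proof.
  unfold extend; destruct excluded_middle_informative; auto using witness_consistent.
Qed.

Section Henkin.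

Variable p0 : form.
Hypothesis p0_unprovable : ~ proves [] p0.

Fixpoint chain (n : nat) : list form :=
  match n with
  | 0 => [fImp p0 fBot]
  | S n => extend (chain n) (enum n)
  end.

Lemma chain_consistent n : consistent (chain n).
Proof.
  induction n; cbn; [apply consistent_neg; auto | apply extend_consistent; auto].
Qed.

Lemma chain_incl n m : n <= m -> incl (chain n) (chain m).
Proof.
  induction 1; [apply incl_refl|]. cbn; unfold extend.
  destruct excluded_middle_informative; auto.
  apply incl_appr, incl_tl; auto.
Qed.

(** The maximal consistent theory with witnesses. *)
Definition Omega (p : form) : Prop := exists n, proves (chain n) p.

Lemma Omega_closed G p : nd G p -> (forall q, In q G -> Omega q) -> Omega p.
Proof.
  revert p; induction G as [|q G IH]; intros p D H.
  - exists 0; apply (proves_weaken []); [intros r []|]; apply proves_lift; auto.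
  - destruct (IH (fImp q p)) as [n Hn].
    + apply nd_impI; auto.
    + intros; apply H; cbn; auto.
    + destruct (H q) as [m Hm]; [cbn; auto|].
      exists (max n m); apply proves_impE with q.
      * eapply proves_weaken; [apply chain_incl | exact Hn]; lia.
      * eapply proves_weaken; [apply chain_incl | exact Hm]; lia.
Qed.

Lemma Omega_T p : T p -> Omega p.
Proof.
  intros H; exists 0, [p]; split.
  - intros q [<-|[]]; auto.
  - apply nd_hyp; cbn; auto.
Qed.

Lemma Omega_bot : ~ Omega fBot.
Proof. intros [n H]; exact (chain_consistent n H). Qed.

Lemma Omega_impE p q : Omega (fImp p q) -> Omega p -> Omega q.
Proof.
  intros Hpq Hp; apply (Omega_closed [fImp p q; p]).
  - apply nd_impE with p; apply nd_hyp; cbn; auto.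
  - intros r [<-|[<-|[]]]; auto.
Qed.

Lemma enum_consistent_in n :
  consistent (enum n :: chain n) ->
  incl (witness (chain n) (enum n) ++ [enum n]) (chain (S n)).
Proof.
  intros C; cbn; unfold extend; destruct excluded_middle_informative; [|tauto].
  intros q; rewrite !in_app_iff; cbn; tauto.
Qed.

(** Each formula is examined at some stage and is added there unless it is
    refuted. *)
Lemma Omega_complete p : Omega p \/ Omega (fImp p fBot).
Proof.
  destruct (enum_surj p) as [n <-].
  destruct (classic (consistent (enum n :: chain n))) as [C|C].
  - left; exists (S n); apply proves_hyp, (enum_consistent_in n C), in_app_iff; cbn; auto.
  - right; exists n; apply proves_impI, NNPP, C.
Qed.

Lemma Omega_imp p q : (Omega p -> Omega q) -> Omega (fImp p q).
Proof.
  intros H; destruct (Omega_complete p) as [Hp|Hp].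
  - apply (Omega_closed [q]); [apply nd_impI, nd_hyp; cbn; auto|].
    intros r [<-|[]]; auto.
  - apply (Omega_closed [fImp p fBot]); [|intros r [<-|[]]; auto].
    apply nd_impI, nd_raa, nd_impE with p; apply nd_hyp; cbn; auto.
Qed.

(** Otherwise the negation of [fAll p] is in [Omega], and the stage at which
    it is examined has added a refuted instance of [p]. *)
Lemma Omega_witness p :
  (forall t, Omega (subst0 t p)) -> Omega (fAll p).
Proof.
  intros H; destruct (Omega_complete (fAll p)) as [|Hn]; auto; exfalso.
  destruct (enum_surj (fImp (fAll p) fBot)) as [n En].
  assert (C : consistent (enum n :: chain n)).
  { intros C; apply Omega_bot; apply (Omega_impE (enum n)).
    - exists n; apply proves_impI, C.
    - rewrite En; auto. }
  pose proof (enum_consistent_in n C) as I; rewrite En in I; cbn [witness] in I.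
  eapply Omega_bot, Omega_impE; [|apply (H (fresh (enum n :: chain n)))].
  exists (S n); apply proves_hyp, I; rewrite En; left; reflexivity.
Qed.

Definition equal (x y : nat) : Prop := Omega (fEq x y).

Lemma equal_subst x y p : equal x y -> Omega (subst0 x p) -> Omega (subst0 y p).
Proof.
  intros Hxy Hx; apply (Omega_closed [fEq x y; subst0 x p]).
  - apply nd_eqE with x; apply nd_hyp; cbn; auto.
  - intros r [<-|[<-|[]]]; auto.
Qed.

Lemma equal_refl x : equal x x.
Proof. apply (Omega_closed []); [apply nd_eqI | intros q []]. Qed.

Lemma equal_sym x y : equal x y -> equal y x.
Proof. intros H; apply (equal_subst x y (fEq 0 (S x)) H), equal_refl. Qed.

Lemma equal_trans x y z : equal x y -> equal y z -> equal x z.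
Proof.
  intros H1 H2; apply (equal_subst y x (fEq 0 (S z)) (equal_sym _ _ H1) H2).
Qed.

(** A chosen representative of each class of provably equal variables: the
    quotient is realised as a set of variables, so that equality of the
    language becomes equality of the model. *)
Definition rep (x : nat) : nat := epsilon (inhabits 0) (equal x).

Lemma rep_equal x : equal x (rep x).
Proof. unfold rep; apply epsilon_spec; exists x; apply equal_refl. Qed.

Lemma rep_eq x y : equal x y -> rep x = rep y.
Proof.
  intros H; unfold rep; f_equal; apply functional_extensionality; intros z.
  apply propositional_extensionality; split; eauto using equal_trans, equal_sym.
Qed.

Definition term_model : Type := {x : nat | rep x = x}.

Definition class (x : nat) : term_model :=
  exist _ (rep x) (eq_sym (rep_eq x (rep x) (rep_equal x))).

Lemma class_eq x y : class x = class y <-> equal x y.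
Proof.
  split; intros H.
  - apply (f_equal (@proj1_sig _ _)) in H; cbn in H.
    apply equal_trans with (rep x); [apply rep_equal|].
    rewrite H; apply equal_sym, rep_equal.
  - apply eq_sig_uncurried; exists (rep_eq x y H).
    apply (UIP_dec Nat.eq_dec).
Qed.

Lemma class_proj (c : term_model) : class (proj1_sig c) = c.
Proof.
  destruct c as [x Hx]; apply eq_sig_uncurried; exists Hx.
  apply (UIP_dec Nat.eq_dec).
Qed.

Definition term_mem (c d : term_model) : Prop :=
  Omega (fMem (proj1_sig c) (proj1_sig d)).

Lemma term_mem_class x y : term_mem (class x) (class y) <-> Omega (fMem x y).
Proof.
  assert (E : forall x x' y y', equal x x' -> equal y y' ->
                Omega (fMem x y) -> Omega (fMem x' y')).
  { intros a a' b b' Ha Hb H.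
    apply (equal_subst b b' (fMem (S a') 0) Hb).
    exact (equal_subst a a' (fMem 0 (S b)) Ha H). }
  unfold term_mem; cbn; split; apply E; auto using rep_equal, equal_sym.
Qed.

Lemma truth p : forall s,
  sat term_mem (fun k => class (s k)) p <-> Omega (ren s p).
Proof.
  induction p as [|x y|x y|p IHp q IHq|p IHp]; intros s; cbn.
  - split; [tauto | apply Omega_bot].
  - apply class_eq.
  - apply term_mem_class.
  - rewrite IHp, IHq; split; [apply Omega_imp | apply Omega_impE].
  - assert (E : forall t, sat term_mem (scons (class t) (fun k => class (s k))) p
                  <-> Omega (subst0 t (ren (up s) p))).
    { intros t; unfold subst0; rewrite ren_comp.
      rewrite <- (IHp (fun k => match up s k with 0 => t | S k' => k' end)).
      replace (scons (class t) (fun k => class (s k))) with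
        (fun k => class (match up s k with 0 => t | S k' => k' end)); [tauto|].
      apply functional_extensionality; intros [|k]; reflexivity. }
    split.
    + intros H; apply Omega_witness; intros t; apply E, H.
    + intros H c; rewrite <- (class_proj c); apply E.
      apply (Omega_closed [fAll (ren (up s) p)]); [|intros r [<-|[]]; auto].
      apply nd_allE, nd_hyp; cbn; auto.
Qed.

Lemma term_model_T p : T p -> forall r, sat term_mem r p.
Proof.
  intros H r; replace r with (fun k => class (proj1_sig (r k))).
  - apply truth; rewrite (ren_ext_bounded p 0 _ (fun k => k)), ren_id; auto using Omega_T.
    + apply T_closed; auto.
    + lia.
  - apply functional_extensionality; intros k; apply class_proj.
Qed.

Lemma term_model_refutes : ~ sat term_mem class p0.
Proof.
  intros H; apply (truth p0 (fun k => k)) in H; rewrite ren_id in H; auto.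
  apply Omega_bot, (Omega_impE p0); auto.
  exists 0; apply proves_hyp; cbn; auto.
Qed.

End Henkin.

(** Gödel's completeness theorem, for theories of closed formulas and models
    in which equality is interpreted as equality. *)
Theorem completeness p :
  (forall (M : Type) (mem : M -> M -> Prop),
     (forall q, T q -> forall r, sat mem r q) -> forall r, sat mem r p) ->
  provable T p.
Proof.
  intros H; apply NNPP; intros N.
  assert (U : ~ proves [] p).
  { intros [G [HT D]]; apply N; exists G; rewrite app_nil_r in D; auto. }
  apply (term_model_refutes p U), H; intros q Hq r; exact (term_model_T p U q Hq r).
Qed.

End Completeness.

(** * Definable predicates of a model of ZF *)

(** Interleaving: [r] on the even positions, [s] on the odd ones. *)
Fixpoint mix {A : Type} (r s : nat -> A) (n : nat) : A :=
  match n with 0 => r 0 | S n => mix s (fun k => r (S k)) n end.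

Lemma mix_even {A} k : forall r s : nat -> A, mix r s (2 * k) = r k.
Proof.
  induction k; intros r s; [reflexivity|].
  replace (2 * S k) with (S (S (2 * k))) by lia; cbn [mix]; apply IHk.
Qed.

Lemma mix_odd {A} k : forall r s : nat -> A, mix r s (S (2 * k)) = s k.
Proof. intros r s; cbn [mix]; apply mix_even. Qed.

Lemma mix_map {A B} (e : A -> B) n : forall r s : nat -> A,
  e (mix r s n) = mix (fun k => e (r k)) (fun k => e (s k)) n.
Proof. induction n; intros r s; cbn [mix]; auto. Qed.

Section Model.

Variable M : Type.
Variable mem : M -> M -> Prop.
Variable point : M.
Hypothesis ZF_model : forall p, ZF p -> forall r, sat mem r p.

Notation "x ∈ y" := (mem x y) (at level 70).

(** Definability with parameters, for predicates of assignments.  The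
    parameters occupy the odd variables, so that predicates with different
    parameters can be combined without knowing how many variables each uses. *)
Definition Def (P : (nat -> M) -> Prop) : Prop :=
  exists p s, forall r, sat mem (mix r s) p <-> P r.

(** Definability, by its graph, of an operation on assignments. *)
Definition DefT (t : (nat -> M) -> M) : Prop :=
  Def (fun r => r 0 = t (fun k => r (S k))).

Lemma Def_ext P Q : Def P -> (forall r, P r <-> Q r) -> Def Q.
Proof. intros [p [s H]] E; exists p, s; intros r; rewrite H; apply E. Qed.

Lemma Def_rename P f : Def P -> Def (fun r => P (fun k => r (f k))).
Proof.
  intros [p [s H]].
  exists (ren (mix (fun k => 2 * f k) (fun k => S (2 * k))) p), s; intros r.
  rewrite sat_ren, <- H.
  match goal with |- sat _ ?e _ <-> sat _ ?e' _ => replace e with e'; [tauto|] end.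
  apply functional_extensionality; intros n; rewrite (mix_map (mix _ _) n); f_equal;
    apply functional_extensionality; intros k;
    rewrite ?mix_even, ?mix_odd; reflexivity.
Qed.

Lemma Def_imp P Q : Def P -> Def Q -> Def (fun r => P r -> Q r).
Proof.
  intros [p [s H]] [q [s' H']].
  exists (fImp (ren (mix (fun k => 2 * k) (fun k => S (2 * (2 * k)))) p)
               (ren (mix (fun k => 2 * k) (fun k => S (2 * S (2 * k)))) q)), (mix s s').
  intros r; cbn [sat]; rewrite !sat_ren, <- H, <- H'.
  match goal with |- (sat _ ?e _ -> sat _ ?f _) <-> (sat _ ?e' _ -> sat _ ?f' _) =>
    replace e with e'; [replace f with f'; [tauto|]|] end;
  apply functional_extensionality; intros n; rewrite (mix_map (mix _ _) n); f_equal;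
    apply functional_extensionality; intros k;
    rewrite ?mix_even, ?mix_odd, ?mix_even, ?mix_odd; reflexivity.
Qed.

Lemma Def_all (P : (nat -> M) -> M -> Prop) :
  Def (fun r => P (fun k => r (S k)) (r 0)) -> Def (fun r => forall x, P r x).
Proof.
  intros [p [s H]].
  exists (fAll (ren (mix (fun k => match k with 0 => 0 | S k => S (2 * k) end)
                    (fun k => S (S (2 * k)))) p)), s.
  intros r; cbn [sat].
  assert (E : forall v, (fun k => scons v (mix r s)
     (mix (fun k => match k with 0 => 0 | S k => S (2 * k) end) (fun k => S (S (2 * k))) k))
     = mix (scons v r) s).
  { intros v; apply functional_extensionality; intros n;
      rewrite (mix_map (scons v (mix r s)) n); f_equal;
      apply functional_extensionality; intros [|k]; cbn [scons];
      rewrite ?mix_even, ?mix_odd; reflexivity. }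
  split; intros K v; specialize (K v).
  - rewrite sat_ren, E, H in K; exact K.
  - rewrite sat_ren, E, H; exact K.
Qed.

(** Classically, such a predicate is everywhere true or everywhere false. *)
Lemma Def_const (P : Prop) : Def (fun _ => P).
Proof.
  destruct (classic P) as [H|H].
  - exists (fEq 0 0), (fun _ => point); cbn; tauto.
  - exists fBot, (fun _ => point); cbn; tauto.
Qed.

Lemma Def_not P : Def P -> Def (fun r => ~ P r).
Proof. intros H; apply (Def_imp _ _ H), Def_const. Qed.

Lemma Def_or P Q : Def P -> Def Q -> Def (fun r => P r \/ Q r).
Proof.
  intros HP HQ; apply (Def_ext (fun r => ~ P r -> Q r));
    [auto using Def_imp, Def_not | intros r; tauto].
Qed.

Lemma Def_and P Q : Def P -> Def Q -> Def (fun r => P r /\ Q r).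
Proof.
  intros HP HQ; apply (Def_ext (fun r => ~ (P r -> ~ Q r)));
    [auto using Def_imp, Def_not | intros r; tauto].
Qed.

Lemma Def_ex (P : (nat -> M) -> M -> Prop) :
  Def (fun r => P (fun k => r (S k)) (r 0)) -> Def (fun r => exists x, P r x).
Proof.
  intros H; apply (Def_ext (fun r => ~ forall x, ~ P r x)).
  - apply Def_not, Def_all, Def_not, H.
  - intros r; split.
    + intros K; apply NNPP; intros N; apply K; intros x Hx; apply N; eauto.
    + intros [x Hx] K; exact (K x Hx).
Qed.

Lemma DefT_rename t f : DefT t -> DefT (fun r => t (fun k => r (f k))).
Proof.
  intros H; exact (Def_rename _ (fun k => match k with 0 => 0 | S k => S (f k) end) H).
Qed.

Lemma Def_subst (P : (nat -> M) -> M -> Prop) t :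
  Def (fun r => P (fun k => r (S k)) (r 0)) -> DefT t -> Def (fun r => P r (t r)).
Proof.
  intros HP Ht; apply (Def_ext (fun r => exists x, x = t r /\ P r x)).
  - apply Def_ex, Def_and; auto.
  - intros r; split; [intros [x [-> H]]; auto | eauto].
Qed.

Lemma DefT_var i : DefT (fun r => r i).
Proof.
  exists (fEq (2 * 0) (2 * S i)), (fun _ => point); intros r; cbn [sat].
  rewrite !mix_even; tauto.
Qed.

Lemma DefT_const c : DefT (fun _ => c).
Proof.
  exists (fEq (2 * 0) (S (2 * 0))), (fun _ => c); intros r; cbn [sat].
  rewrite mix_even, mix_odd; tauto.
Qed.

Lemma Def_mem t u : DefT t -> DefT u -> Def (fun r => t r ∈ u r).
Proof.
  intros Ht Hu.
  apply (Def_subst (fun r x => x ∈ u r) t); auto.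
  apply (Def_subst (fun r y => r 0 ∈ y) (fun r => u (fun k => r (S k))));
    [|apply DefT_rename; auto].
  exists (fMem (2 * 1) (2 * 0)), (fun _ => point); intros r; cbn [sat].
  rewrite !mix_even; tauto.
Qed.

Lemma Def_eq t u : DefT t -> DefT u -> Def (fun r => t r = u r).
Proof.
  intros Ht Hu.
  apply (Def_subst (fun r x => x = u r) t); auto.
Qed.

Lemma Def_pred (P : M -> Prop) t :
  Def (fun r => P (r 0)) -> DefT t -> Def (fun r => P (t r)).
Proof. intros HP Ht; apply (Def_subst (fun _ x => P x)); auto. Qed.

Lemma Def_rel (P : M -> M -> Prop) t u :
  Def (fun r => P (r 0) (r 1)) -> DefT t -> DefT u -> Def (fun r => P (t r) (u r)).
Proof.
  intros HP Ht Hu; apply (Def_subst (fun r x => P x (u r)) t); auto.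
  apply (Def_subst (fun r y => P (r 0) y) (fun r => u (fun k => r (S k))));
    [|apply DefT_rename; auto].
  exact (Def_rename _ (fun k => match k with 0 => 1 | _ => 0 end) HP).
Qed.

(** Operations and predicates are treated separately because [DefT] unfolds to
    [Def] of an equation, to which [Def_eq] would apply again. *)
Ltac def_step :=
  cbv beta;
  lazymatch goal with
  | |- DefT _ =>
      first
        [ assumption | apply DefT_var | apply DefT_const
        | match goal with
          | H : DefT ?t |- DefT (fun r => ?t (fun k => r (@?f k))) =>
              exact (DefT_rename t f H)
          end ]
  | |- Def _ =>
      first
        [ assumption | apply Def_const | apply Def_mem | apply Def_eq
        | apply Def_and | apply Def_or | apply Def_not | apply Def_ex
        | apply Def_imp | apply Def_all
        | match goal with
          | H : Def (fun r => ?P (r 0) (r 1)) |- Def (fun r => ?P (@?t r) (@?u r)) =>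
              apply (Def_rel P t u H)
          | H : Def (fun r => ?P (r 0)) |- Def (fun r => ?P (@?t r)) =>
              apply (Def_pred P t H)
          end ]
  end.

Ltac def := repeat def_step.

(** * Meaning of the formulas in a model *)

(** The value, at quantifier depth [d], of the variable of level [x]. *)
Definition lv (r : nat -> M) (d : nat) (x : var) : M := r (d - S x).

Lemma lv_top r v d : lv (scons v r) (S d) d = v.
Proof. unfold lv; rewrite Nat.sub_diag; reflexivity. Qed.

Lemma lv_old r v d x : x < d -> lv (scons v r) (S d) x = lv r d x.
Proof. intros H; unfold lv; replace (S d - S x) with (S (d - S x)) by lia; reflexivity. Qed.

Lemma sat_pmem r x y d : sat mem r (pmem x y d) <-> lv r d x ∈ lv r d y.
Proof. reflexivity. Qed.

Lemma sat_peq r x y d : sat mem r (peq x y d) <-> lv r d x = lv r d y.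
Proof. reflexivity. Qed.

Lemma sat_pall r P d (Q : M -> Prop) :
  (forall v, sat mem (scons v r) (P d (S d)) <-> Q v) ->
  (sat mem r (pall P d) <-> forall v, Q v).
Proof. intros H; cbn; split; intros K v; apply H, K. Qed.

Lemma sat_pimp r P P' d (Q Q' : Prop) :
  (sat mem r (P d) <-> Q) -> (sat mem r (P' d) <-> Q') ->
  (sat mem r (pimp P P' d) <-> (Q -> Q')).
Proof. cbn; tauto. Qed.

Lemma sat_pnot r P d (Q : Prop) :
  (sat mem r (P d) <-> Q) -> (sat mem r (pnot P d) <-> ~ Q).
Proof. cbn; tauto. Qed.

Lemma sat_por r P P' d (Q Q' : Prop) :
  (sat mem r (P d) <-> Q) -> (sat mem r (P' d) <-> Q') ->
  (sat mem r (por P P' d) <-> Q \/ Q').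
Proof. cbn; tauto. Qed.

Lemma sat_pand r P P' d (Q Q' : Prop) :
  (sat mem r (P d) <-> Q) -> (sat mem r (P' d) <-> Q') ->
  (sat mem r (pand P P' d) <-> Q /\ Q').
Proof. cbn; tauto. Qed.

Lemma sat_piff r P P' d (Q Q' : Prop) :
  (sat mem r (P d) <-> Q) -> (sat mem r (P' d) <-> Q') ->
  (sat mem r (piff P P' d) <-> (Q <-> Q')).
Proof. cbn; tauto. Qed.

Lemma sat_pex r P d (Q : M -> Prop) :
  (forall v, sat mem (scons v r) (P d (S d)) <-> Q v) ->
  (sat mem r (pex P d) <-> exists v, Q v).
Proof.
  intros H; cbn; split.
  - intros K; apply NNPP; intros N; apply K; intros v Hv; apply N; exists v; apply H, Hv.
  - intros [v Hv] K; apply (K v), H, Hv.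
Qed.

Lemma sat_all_in r A P d a (Q : M -> Prop) :
  A < d -> lv r d A = a -> (forall v, sat mem (scons v r) (P d (S d)) <-> Q v) ->
  (sat mem r (all_in A P d) <-> forall v, v ∈ a -> Q v).
Proof.
  intros HA <- H; apply sat_pall; intros v; apply sat_pimp; auto.
  rewrite sat_pmem, lv_top, lv_old by auto; reflexivity.
Qed.

Lemma sat_ex_in r A P d a (Q : M -> Prop) :
  A < d -> lv r d A = a -> (forall v, sat mem (scons v r) (P d (S d)) <-> Q v) ->
  (sat mem r (ex_in A P d) <-> exists v, v ∈ a /\ Q v).
Proof.
  intros HA <- H; apply sat_pex; intros v; apply sat_pand; auto.
  rewrite sat_pmem, lv_top, lv_old by auto; reflexivity.
Qed.

Hint Rewrite sat_pmem sat_peq lv_top : den.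
Hint Rewrite lv_old using lia : den.

(** Computes the meaning of a formula by descending through its connectives;
    a formula with a name is replaced by its known meaning. *)
Ltac den :=
  cbv beta;
  lazymatch goal with
  | |- sat _ _ (all_in _ _ _) <-> _ => apply sat_all_in; [lia | autorewrite with den; reflexivity | intro; den]
  | |- sat _ _ (ex_in _ _ _) <-> _ => apply sat_ex_in; [lia | autorewrite with den; reflexivity | intro; den]
  | |- sat _ _ (pall _ _) <-> _ => apply sat_pall; intro; den
  | |- sat _ _ (pex _ _) <-> _ => apply sat_pex; intro; den
  | |- sat _ _ (pnot _ _) <-> _ => apply sat_pnot; den
  | |- sat _ _ (pand _ _ _) <-> _ => apply sat_pand; den
  | |- sat _ _ (por _ _ _) <-> _ => apply sat_por; den
  | |- sat _ _ (piff _ _ _) <-> _ => apply sat_piff; den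
  | |- sat _ _ (pimp _ _ _) <-> _ => apply sat_pimp; den
  | _ => autorewrite with den; reflexivity
  end.

(** The following predicates are the meanings in [M] of the formulas with the
    corresponding names. *)
Definition Subset x y := forall z, z ∈ x -> z ∈ y.
Definition IsEmpty x := forall z, ~ z ∈ x.
Definition Nonempty x := exists z, z ∈ x.
Definition Disjoint x y := ~ exists z, z ∈ x /\ z ∈ y.
Definition IsUnion u F := forall x, x ∈ u <-> exists y, y ∈ F /\ x ∈ y.
Definition IsDiff d x y := forall z, z ∈ d <-> z ∈ x /\ ~ z ∈ y.
Definition IsUpair p x y := forall z, z ∈ p <-> z = x \/ z = y.
Definition IsSucc s x := forall z, z ∈ s <-> z ∈ x \/ z = x.
Definition InductiveSet w :=
  (exists e, e ∈ w /\ IsEmpty e) /\ forall x, x ∈ w -> exists s, s ∈ w /\ IsSucc s x.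
Definition IsOmega w := InductiveSet w /\ forall v, InductiveSet v -> Subset w v.

Lemma sat_subset r x y d : x < d -> y < d ->
  sat mem r (subset x y d) <-> Subset (lv r d x) (lv r d y).
Proof. intros; unfold subset, Subset; den. Qed.
Hint Rewrite sat_subset using lia : den.

Lemma sat_is_empty r x d : x < d -> sat mem r (is_empty x d) <-> IsEmpty (lv r d x).
Proof. intros; unfold is_empty, IsEmpty; den. Qed.
Hint Rewrite sat_is_empty using lia : den.

Lemma sat_nonempty r x d : x < d -> sat mem r (nonempty x d) <-> Nonempty (lv r d x).
Proof. intros; unfold nonempty, Nonempty; den. Qed.
Hint Rewrite sat_nonempty using lia : den.

Lemma sat_disjoint r x y d : x < d -> y < d ->
  sat mem r (disjoint x y d) <-> Disjoint (lv r d x) (lv r d y).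
Proof. intros; unfold disjoint, Disjoint; den. Qed.
Hint Rewrite sat_disjoint using lia : den.

Lemma sat_is_union r x y d : x < d -> y < d ->
  sat mem r (is_union x y d) <-> IsUnion (lv r d x) (lv r d y).
Proof. intros; unfold is_union, IsUnion; den. Qed.
Hint Rewrite sat_is_union using lia : den.

Lemma sat_is_diff r x y z d : x < d -> y < d -> z < d ->
  sat mem r (is_diff x y z d) <-> IsDiff (lv r d x) (lv r d y) (lv r d z).
Proof. intros; unfold is_diff, IsDiff; den. Qed.
Hint Rewrite sat_is_diff using lia : den.

Lemma sat_is_upair r x y z d : x < d -> y < d -> z < d ->
  sat mem r (is_upair x y z d) <-> IsUpair (lv r d x) (lv r d y) (lv r d z).
Proof. intros; unfold is_upair, IsUpair; den. Qed.
Hint Rewrite sat_is_upair using lia : den.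

Lemma sat_is_succ r x y d : x < d -> y < d ->
  sat mem r (is_succ x y d) <-> IsSucc (lv r d x) (lv r d y).
Proof. intros; unfold is_succ, IsSucc; den. Qed.
Hint Rewrite sat_is_succ using lia : den.

Lemma sat_inductive_set r x d : x < d ->
  sat mem r (inductive_set x d) <-> InductiveSet (lv r d x).
Proof. intros; unfold inductive_set, InductiveSet; den. Qed.
Hint Rewrite sat_inductive_set using lia : den.

Lemma sat_is_omega r x d : x < d -> sat mem r (is_omega x d) <-> IsOmega (lv r d x).
Proof. intros; unfold is_omega, IsOmega; den. Qed.
Hint Rewrite sat_is_omega using lia : den.

(** * The axioms of ZF in a model *)

Lemma extensionality x y : (forall z, z ∈ x <-> z ∈ y) -> x = y.
Proof.
  assert (H : sat mem (fun _ => point) (ax_extensionality 0) <->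
    forall x y, (forall z, z ∈ x <-> z ∈ y) -> x = y) by (unfold ax_extensionality; den).
  apply H, ZF_model, ZF_extensionality.
Qed.

Lemma pairing x y : exists p, IsUpair p x y.
Proof.
  assert (H : sat mem (fun _ => point) (ax_pairing 0) <->
    forall x y, exists p, IsUpair p x y) by (unfold ax_pairing; den).
  apply H, ZF_model, ZF_pairing.
Qed.

Lemma union_exists F : exists u, IsUnion u F.
Proof.
  assert (H : sat mem (fun _ => point) (ax_union 0) <->
    forall F, exists u, IsUnion u F) by (unfold ax_union; den).
  apply H, ZF_model, ZF_union.
Qed.

Lemma powerset_exists x : exists P, forall y, y ∈ P <-> Subset y x.
Proof.
  assert (H : sat mem (fun _ => point) (ax_powerset 0) <->
    forall x, exists P, forall y, y ∈ P <-> Subset y x) by (unfold ax_powerset; den).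
  apply H, ZF_model, ZF_powerset.
Qed.

Lemma infinity : exists w, InductiveSet w.
Proof.
  assert (H : sat mem (fun _ => point) (ax_infinity 0) <->
    exists w, InductiveSet w) by (unfold ax_infinity; den).
  apply H, ZF_model, ZF_infinity.
Qed.

Lemma sat_fAlls n p : (forall r, sat mem r (fAlls n p)) -> forall r, sat mem r p.
Proof.
  induction n; intros H; [exact H|]; apply IHn; intros r.
  replace r with (scons (r 0) (fun k => r (S k))); [apply H|].
  apply functional_extensionality; intros [|k]; reflexivity.
Qed.

Lemma closed_fAlls n p : bounded n p -> closed (fAlls n p).
Proof.
  unfold closed; replace n with (n + 0) at 1 by lia; generalize 0.
  induction n; intros m H; [exact H|]; cbn; apply IHn.
  replace (n + S m) with (S n + m) by lia; exact H.
Qed.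

Theorem separation (P : M -> Prop) : Def (fun r => P (r 0)) ->
  forall a, exists b, forall z, z ∈ b <-> z ∈ a /\ P z.
Proof.
  intros [p [s H]].
  (* [mix (scons z c) s] is [scons z (mix s c)]: putting the argument in front
     exchanges the roles of the two sequences *)
  set (e := mix s (fun _ => point)).
  assert (Hp : forall z, sat mem (scons z e) p <-> P z).
  { intros z; rewrite <- (H (scons z (fun _ => point))).
    replace (mix (scons z (fun _ => point)) s) with (scons z e); [tauto|].
    apply functional_extensionality; intros [|k]; reflexivity. }
  assert (K : sat mem e (ax_separation p 0) <->
    forall a, exists b, forall z, z ∈ b <-> z ∈ a /\ P z).
  { unfold ax_separation.
    apply sat_pall; intros a; apply sat_pex; intros b; apply sat_pall; intros z.
    apply sat_piff; [den | apply sat_pand; [den|]].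
    unfold app1; rewrite sat_ren, <- Hp.
    match goal with |- sat _ ?e _ <-> sat _ ?e' _ => replace e with e'; [tauto|] end.
    apply functional_extensionality; intros [|k]; reflexivity. }
  apply K; revert e Hp K; intros e _ _; revert e.
  apply (sat_fAlls (var_bound (ax_separation p 0))), ZF_model, ZF_separation.
  apply closed_fAlls, bounded_var_bound.
Qed.

(** * Ordered pairs and relations *)

Definition upair x y : M :=
  proj1_sig (constructive_indefinite_description _ (pairing x y)).

Lemma in_upair x y z : z ∈ upair x y <-> z = x \/ z = y.
Proof.
  exact (proj2_sig (constructive_indefinite_description _ (pairing x y)) z).
Qed.

Lemma IsUpair_upair p x y : IsUpair p x y <-> p = upair x y.
Proof.
  split; [intros H; apply extensionality; intros z; rewrite in_upair; apply H|].
  intros -> z; apply in_upair.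
Qed.

Definition opair x y : M := upair (upair x x) (upair x y).

Lemma upair_inj x y y' : upair x y = upair x y' -> y = y'.
Proof.
  intros H.
  assert (H1 : y ∈ upair x y') by (rewrite <- H; apply in_upair; auto).
  assert (H2 : y' ∈ upair x y) by (rewrite H; apply in_upair; auto).
  apply in_upair in H1, H2; intuition congruence.
Qed.

Lemma opair_inj a b c d : opair a b = opair c d -> a = c /\ b = d.
Proof.
  intros H.
  assert (E : a = c).
  { assert (H1 : upair a a ∈ opair c d) by (rewrite <- H; apply in_upair; auto).
    assert (H2 : c ∈ upair a a).
    { apply in_upair in H1; destruct H1 as [->| ->]; apply in_upair; auto. }
    apply in_upair in H2; intuition congruence. }
  subst c; split; auto.
  apply upair_inj in H; apply upair_inj in H; auto.
Qed.

Lemma DefT_upair t u : DefT t -> DefT u -> DefT (fun r => upair (t r) (u r)).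
Proof.
  intros Ht Hu.
  apply (Def_ext (fun r => forall z, z ∈ r 0 <->
    z = t (fun k => r (S k)) \/ z = u (fun k => r (S k)))).
  - unfold iff; def.
  - intros r; apply IsUpair_upair.
Qed.

Lemma DefT_opair t u : DefT t -> DefT u -> DefT (fun r => opair (t r) (u r)).
Proof. intros Ht Hu; apply DefT_upair; apply DefT_upair; auto. Qed.

(** The same procedure, with pairs among the operations. *)
Ltac def ::=
  repeat (cbv beta; lazymatch goal with
          | |- DefT (fun r => opair _ _) => apply DefT_opair
          | _ => def_step
          end).

Definition IsRel S A B :=
  forall p, p ∈ S -> exists x, x ∈ A /\ exists y, y ∈ B /\ p = opair x y.
Definition IsProd P A B :=
  forall p, p ∈ P <-> exists x, x ∈ A /\ exists y, y ∈ B /\ p = opair x y.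
Definition IsFun f A B :=
  IsRel f A B /\
  forall x, x ∈ A -> exists y, opair x y ∈ f /\ forall y', opair x y' ∈ f -> y' = y.

Lemma sat_is_opair r p x y d : p < d -> x < d -> y < d ->
  sat mem r (is_opair p x y d) <-> lv r d p = opair (lv r d x) (lv r d y).
Proof.
  intros; transitivity (exists u v, IsUpair u (lv r d x) (lv r d x) /\
    IsUpair v (lv r d x) (lv r d y) /\ IsUpair (lv r d p) u v).
  - unfold is_opair; den.
  - unfold opair; split.
    + intros [u [v K]]; rewrite !IsUpair_upair in K; destruct K as [-> [-> K]]; auto.
    + intros ->; do 2 eexists; rewrite !IsUpair_upair; eauto.
Qed.
Hint Rewrite sat_is_opair using lia : den.

Lemma sat_holds r S x y d : S < d -> x < d -> y < d ->
  sat mem r (holds S x y d) <-> opair (lv r d x) (lv r d y) ∈ lv r d S.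
Proof.
  intros; transitivity (exists p, p ∈ lv r d S /\ p = opair (lv r d x) (lv r d y)).
  - unfold holds; den.
  - split; [intros [p [K ->]]; auto | eauto].
Qed.
Hint Rewrite sat_holds using lia : den.

Lemma sat_is_prod r P A B d : P < d -> A < d -> B < d ->
  sat mem r (is_prod P A B d) <-> IsProd (lv r d P) (lv r d A) (lv r d B).
Proof. intros; unfold is_prod, IsProd; den. Qed.
Hint Rewrite sat_is_prod using lia : den.

Lemma sat_is_rel r S A B d : S < d -> A < d -> B < d ->
  sat mem r (is_rel S A B d) <-> IsRel (lv r d S) (lv r d A) (lv r d B).
Proof. intros; unfold is_rel, IsRel; den. Qed.
Hint Rewrite sat_is_rel using lia : den.

Lemma sat_is_fun r f A B d : f < d -> A < d -> B < d ->
  sat mem r (is_fun f A B d) <-> IsFun (lv r d f) (lv r d A) (lv r d B).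
Proof. intros; unfold is_fun, IsFun; den. Qed.
Hint Rewrite sat_is_fun using lia : den.

Definition DependentChoice :=
  forall A S, Nonempty A -> IsRel S A A ->
    (forall x, x ∈ A -> exists y, y ∈ A /\ opair x y ∈ S) ->
    forall w, IsOmega w ->
    exists a, IsFun a w A /\
      forall n, n ∈ w -> forall m, m ∈ w -> IsSucc m n ->
        forall x, x ∈ A -> forall y, y ∈ A ->
          opair n x ∈ a -> opair m y ∈ a -> opair x y ∈ S.

Lemma sat_DC r d : sat mem r (DC d) <-> DependentChoice.
Proof. unfold DC, DependentChoice; den. Qed.
Hint Rewrite sat_DC : den.

Definition GenTopology X mu :=
  (forall U, U ∈ mu -> Subset U X) /\
  forall F, Subset F mu -> forall U, IsUnion U F -> U ∈ mu.
Definition ClosedIn X mu A := Subset A X /\ forall C, IsDiff C X A -> C ∈ mu.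
Definition Normal X mu :=
  forall A B, ClosedIn X mu A -> ClosedIn X mu B -> Disjoint A B ->
    exists U, U ∈ mu /\ exists V, V ∈ mu /\ Disjoint U V /\ Subset A U /\ Subset B V.
Definition IsPreimage P f X V :=
  forall x, x ∈ P <-> x ∈ X /\ exists y, y ∈ V /\ opair x y ∈ f.
Definition Continuous f X mu nu :=
  forall V, V ∈ nu -> forall P, IsPreimage P f X V -> P ∈ mu.

Lemma sat_gen_topology r X mu d : X < d -> mu < d ->
  sat mem r (gen_topology X mu d) <-> GenTopology (lv r d X) (lv r d mu).
Proof. intros; unfold gen_topology, GenTopology; den. Qed.
Hint Rewrite sat_gen_topology using lia : den.

Lemma sat_closed_in r X mu A d : X < d -> mu < d -> A < d ->
  sat mem r (closed_in X mu A d) <-> ClosedIn (lv r d X) (lv r d mu) (lv r d A).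
Proof. intros; unfold closed_in, ClosedIn; den. Qed.
Hint Rewrite sat_closed_in using lia : den.

Lemma sat_normal r X mu d : X < d -> mu < d ->
  sat mem r (normal X mu d) <-> Normal (lv r d X) (lv r d mu).
Proof. intros; unfold normal, Normal; den. Qed.
Hint Rewrite sat_normal using lia : den.

Lemma sat_is_preimage r P f X V d : P < d -> f < d -> X < d -> V < d ->
  sat mem r (is_preimage P f X V d) <->
  IsPreimage (lv r d P) (lv r d f) (lv r d X) (lv r d V).
Proof. intros; unfold is_preimage, IsPreimage; den. Qed.
Hint Rewrite sat_is_preimage using lia : den.

Lemma sat_continuous r f X mu nu d : f < d -> X < d -> mu < d -> nu < d ->
  sat mem r (continuous f X mu nu d) <->
  Continuous (lv r d f) (lv r d X) (lv r d mu) (lv r d nu).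
Proof. intros; unfold continuous, Continuous; den. Qed.
Hint Rewrite sat_continuous using lia : den.

Definition Op op x y z := opair (opair x y) z ∈ op.
Definition Lt lt x y := opair x y ∈ lt.
Definition Le lt x y := Lt lt x y \/ x = y.
Definition IsBinop op R := forall P, IsProd P R R -> IsFun op P R.
Definition OpComm op R :=
  forall x, x ∈ R -> forall y, y ∈ R -> forall z, z ∈ R -> Op op x y z -> Op op y x z.
Definition OpAssoc op R :=
  forall x, x ∈ R -> forall y, y ∈ R -> forall z, z ∈ R ->
  forall u, u ∈ R -> forall v, v ∈ R -> forall w, w ∈ R ->
  Op op x y u -> Op op u z w -> Op op y z v -> Op op x v w.
Definition OpUnit op R e := forall x, x ∈ R -> Op op x e x.

Lemma sat_op_eq r op x y z d : op < d -> x < d -> y < d -> z < d ->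
  sat mem r (op_eq op x y z d) <-> Op (lv r d op) (lv r d x) (lv r d y) (lv r d z).
Proof.
  intros; transitivity (exists p, p = opair (lv r d x) (lv r d y) /\
    opair p (lv r d z) ∈ lv r d op).
  - unfold op_eq; den.
  - split; [intros [p [-> K]]; auto | unfold Op; eauto].
Qed.
Hint Rewrite sat_op_eq using lia : den.

Lemma sat_le r lt x y d : lt < d -> x < d -> y < d ->
  sat mem r (le lt x y d) <-> Le (lv r d lt) (lv r d x) (lv r d y).
Proof. intros; unfold le, Le, Lt; den. Qed.
Hint Rewrite sat_le using lia : den.

Lemma sat_is_binop r op R d : op < d -> R < d ->
  sat mem r (is_binop op R d) <-> IsBinop (lv r d op) (lv r d R).
Proof. intros; unfold is_binop, IsBinop; den. Qed.
Hint Rewrite sat_is_binop using lia : den.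

Lemma sat_op_comm r op R d : op < d -> R < d ->
  sat mem r (op_comm op R d) <-> OpComm (lv r d op) (lv r d R).
Proof. intros; unfold op_comm, OpComm; den. Qed.
Hint Rewrite sat_op_comm using lia : den.

Lemma sat_op_assoc r op R d : op < d -> R < d ->
  sat mem r (op_assoc op R d) <-> OpAssoc (lv r d op) (lv r d R).
Proof. intros; unfold op_assoc, OpAssoc; den. Qed.
Hint Rewrite sat_op_assoc using lia : den.

Lemma sat_op_unit r op R e d : op < d -> R < d -> e < d ->
  sat mem r (op_unit op R e d) <-> OpUnit (lv r d op) (lv r d R) (lv r d e).
Proof. intros; unfold op_unit, OpUnit; den. Qed.
Hint Rewrite sat_op_unit using lia : den.

Definition IsField R add mul zero one :=
  zero ∈ R /\ one ∈ R /\ ~ zero = one /\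
  IsBinop add R /\ OpComm add R /\ OpAssoc add R /\ OpUnit add R zero /\
  (forall x, x ∈ R -> exists y, y ∈ R /\ Op add x y zero) /\
  IsBinop mul R /\ OpComm mul R /\ OpAssoc mul R /\ OpUnit mul R one /\
  (forall x, x ∈ R -> ~ x = zero -> exists y, y ∈ R /\ Op mul x y one) /\
  (forall x, x ∈ R -> forall y, y ∈ R -> forall z, z ∈ R ->
   forall s, s ∈ R -> forall t, t ∈ R -> forall u, u ∈ R -> forall v, v ∈ R ->
   Op add y z s -> Op mul x s t -> Op mul x y u -> Op mul x z v -> Op add u v t).

Lemma sat_is_field r R add mul zero one d :
  R < d -> add < d -> mul < d -> zero < d -> one < d ->
  sat mem r (is_field R add mul zero one d) <->
  IsField (lv r d R) (lv r d add) (lv r d mul) (lv r d zero) (lv r d one).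
Proof. intros; unfold is_field, IsField; den. Qed.
Hint Rewrite sat_is_field using lia : den.

Definition StrictLinearOrder R lt :=
  IsRel lt R R /\
  (forall x, x ∈ R -> ~ Lt lt x x) /\
  (forall x, x ∈ R -> forall y, y ∈ R -> forall z, z ∈ R ->
   Lt lt x y -> Lt lt y z -> Lt lt x z) /\
  (forall x, x ∈ R -> forall y, y ∈ R -> Lt lt x y \/ x = y \/ Lt lt y x).

Definition UpperBound lt E u := forall x, x ∈ E -> Le lt x u.

Definition OrderComplete R lt :=
  forall E, Subset E R -> Nonempty E -> (exists u, u ∈ R /\ UpperBound lt E u) ->
  exists s, s ∈ R /\ UpperBound lt E s /\
    forall u, u ∈ R -> UpperBound lt E u -> Le lt s u.

Lemma sat_strict_linear_order r R lt d : R < d -> lt < d ->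
  sat mem r (strict_linear_order R lt d) <-> StrictLinearOrder (lv r d R) (lv r d lt).
Proof. intros; unfold strict_linear_order, StrictLinearOrder, Lt; den. Qed.
Hint Rewrite sat_strict_linear_order using lia : den.

Lemma sat_upper_bound r lt E u d : lt < d -> E < d -> u < d ->
  sat mem r (upper_bound lt E u d) <-> UpperBound (lv r d lt) (lv r d E) (lv r d u).
Proof. intros; unfold upper_bound, UpperBound; den. Qed.
Hint Rewrite sat_upper_bound using lia : den.

Lemma sat_order_complete r R lt d : R < d -> lt < d ->
  sat mem r (order_complete R lt d) <-> OrderComplete (lv r d R) (lv r d lt).
Proof. intros; unfold order_complete, OrderComplete; den. Qed.
Hint Rewrite sat_order_complete using lia : den.

Definition IsRealField R add mul lt zero one :=
  IsField R add mul zero one /\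
  StrictLinearOrder R lt /\
  (forall x, x ∈ R -> forall y, y ∈ R -> forall z, z ∈ R ->
   forall s, s ∈ R -> forall t, t ∈ R ->
   Lt lt x y -> Op add x z s -> Op add y z t -> Lt lt s t) /\
  (forall x, x ∈ R -> forall y, y ∈ R -> forall z, z ∈ R ->
   Lt lt zero x -> Lt lt zero y -> Op mul x y z -> Lt lt zero z) /\
  OrderComplete R lt.

Lemma sat_is_real_field r R add mul lt zero one d :
  R < d -> add < d -> mul < d -> lt < d -> zero < d -> one < d ->
  sat mem r (is_real_field R add mul lt zero one d) <->
  IsRealField (lv r d R) (lv r d add) (lv r d mul) (lv r d lt) (lv r d zero) (lv r d one).
Proof. intros; unfold is_real_field, IsRealField, Lt; den. Qed.
Hint Rewrite sat_is_real_field using lia : den.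

Definition IsGtauN nu R lt := forall U, U ∈ nu <->
  IsEmpty U \/ U = R \/
  (exists a, a ∈ R /\ forall x, x ∈ U <-> x ∈ R /\ Lt lt x a) \/
  (exists a, a ∈ R /\ forall x, x ∈ U <-> x ∈ R /\ Lt lt a x) \/
  (exists a, a ∈ R /\ exists b, b ∈ R /\ Le lt a b /\
     forall x, x ∈ U <-> x ∈ R /\ (Lt lt x a \/ Lt lt b x)).

Lemma sat_is_gtau_n r nu R lt d : nu < d -> R < d -> lt < d ->
  sat mem r (is_gtau_n nu R lt d) <-> IsGtauN (lv r d nu) (lv r d R) (lv r d lt).
Proof.
  intros; unfold is_gtau_n, IsGtauN, is_left_ray, is_right_ray, is_two_rays, Lt; den.
Qed.
Hint Rewrite sat_is_gtau_n using lia : den.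

Definition GeneralizedUrysohn X mu :=
  forall R add mul lt zero one, IsRealField R add mul lt zero one ->
  forall nu, IsGtauN nu R lt ->
  forall A B, ClosedIn X mu A -> ClosedIn X mu B -> Disjoint A B ->
    exists f, IsFun f X R /\ Continuous f X mu nu /\
      (forall x, x ∈ A -> opair x zero ∈ f) /\
      (forall x, x ∈ B -> opair x one ∈ f).

Lemma sat_theorem r :
  sat mem r ((DC ⇒ ∀ X mu, gen_topology X mu ⇒ normal X mu ⇒ GUL X mu)%fol 0) <->
  (DependentChoice -> forall X mu,
     GenTopology X mu -> Normal X mu -> GeneralizedUrysohn X mu).
Proof. unfold GUL, GeneralizedUrysohn; den. Qed.

(** * Set-theoretic constructions *)

Lemma IsRel_in S A B x y : IsRel S A B -> opair x y ∈ S -> x ∈ A /\ y ∈ B.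
Proof.
  intros H K; destruct (H _ K) as [a [Ha [b [Hb E]]]].
  apply opair_inj in E; destruct E as [-> ->]; auto.
Qed.

Lemma IsFun_total f A B x : IsFun f A B -> x ∈ A -> exists y, y ∈ B /\ opair x y ∈ f.
Proof.
  intros [Hr H] Hx; destruct (H x Hx) as [y [Hy _]].
  exists y; split; auto; apply (IsRel_in f A B x y Hr Hy).
Qed.

Lemma IsFun_unique f A B x y y' :
  IsFun f A B -> opair x y ∈ f -> opair x y' ∈ f -> y = y'.
Proof.
  intros [Hr H] Hy Hy'.
  destruct (H x (proj1 (IsRel_in f A B x y Hr Hy))) as [z [_ Hz]].
  rewrite (Hz y Hy), (Hz y' Hy'); reflexivity.
Qed.

Lemma union2_exists A B : exists C, forall z, z ∈ C <-> z ∈ A \/ z ∈ B.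
Proof.
  destruct (union_exists (upair A B)) as [C HC]; exists C; intros z; rewrite (HC z).
  split.
  - intros [y [Hy Hz]]; apply in_upair in Hy; destruct Hy; subst; auto.
  - intros [H|H]; [exists A | exists B]; split; auto; apply in_upair; auto.
Qed.

Lemma prod_exists A B : exists P, IsProd P A B.
Proof.
  destruct (union2_exists A B) as [C HC].
  destruct (powerset_exists C) as [P1 H1]; destruct (powerset_exists P1) as [P2 H2].
  destruct (separation (fun p => exists x, x ∈ A /\ exists y, y ∈ B /\ p = opair x y))
    with (a := P2) as [P HP]; [def|].
  exists P; intros p; rewrite (HP p); split; [tauto|]; intros H; split; auto.
  destruct H as [x [Hx [y [Hy ->]]]]; apply H2; intros u Hu; apply H1; intros z Hz.
  apply HC; apply in_upair in Hu; destruct Hu; subst; apply in_upair in Hz;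
    destruct Hz; subst; auto.
Qed.

Lemma rel_separation (P : M -> M -> Prop) A B : Def (fun r => P (r 0) (r 1)) ->
  exists S, IsRel S A B /\ forall x y, opair x y ∈ S <-> x ∈ A /\ y ∈ B /\ P x y.
Proof.
  intros HP; destruct (prod_exists A B) as [AB HAB].
  destruct (separation (fun p => exists x y, p = opair x y /\ P x y))
    with (a := AB) as [S HS]; [def|].
  exists S; split.
  - intros p Hp; apply HAB, HS, Hp.
  - intros x y; rewrite (HS (opair x y)), (HAB (opair x y)); split.
    + intros [[a [Ha [b [Hb E]]]] [c [d [E' H]]]].
      apply opair_inj in E, E'; destruct E, E'; subst; auto.
    + intros [Hx [Hy H]]; split; eauto 6.
Qed.

Lemma omega_exists : exists w, IsOmega w.
Proof.
  destruct infinity as [v [[e [He Hee]] Hs]].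
  destruct (separation (fun n => forall u, InductiveSet u -> n ∈ u)) with (a := v) as [w Hw];
    [unfold InductiveSet, IsEmpty, IsSucc, iff; def|].
  exists w; split; [split|].
  - exists e; split; auto; apply Hw; split; auto.
    intros u [[e' [He' Hee']] _]; replace e with e'; auto.
    apply extensionality; intros z; split; intros Hz; exfalso; firstorder.
  - intros x Hx; apply Hw in Hx; destruct Hx as [Hxv Hx].
    destruct (Hs x Hxv) as [s [Hsv Hsx]]; exists s; split; auto; apply Hw; split; auto.
    intros u Hu; destruct (proj2 Hu x (Hx u Hu)) as [s' [Hs' E]].
    replace s with s'; auto; apply extensionality; intros z; rewrite (E z), (Hsx z); tauto.
  - intros u Hu z Hz; apply Hw in Hz; apply Hz, Hu.
Qed.

Lemma omega_induction w (P : M -> Prop) :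
  IsOmega w -> Def (fun r => P (r 0)) ->
  (forall e, e ∈ w -> IsEmpty e -> P e) ->
  (forall n m, n ∈ w -> m ∈ w -> IsSucc m n -> P n -> P m) ->
  forall n, n ∈ w -> P n.
Proof.
  intros [[[e [He Hee]] Hs] Hmin] HP H0 HS.
  destruct (separation P HP w) as [v Hv].
  assert (I : InductiveSet v).
  { split; [exists e; split; auto; apply Hv; auto|].
    intros x Hx; apply Hv in Hx; destruct Hx as [Hx HPx].
    destruct (Hs x Hx) as [s [Hsw Hsx]]; exists s; split; auto; apply Hv; eauto. }
  intros n Hn; apply (Hmin v I n) in Hn; apply Hv in Hn; tauto.
Qed.

(** * Dependent choice without indices *)

(** The order [n <= m] of [w].  In this form it is compared with a preorder
    along the sequence by a single choice of [T]. *)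
Definition Reach w n m := forall T, n ∈ T ->
  (forall k, k ∈ T -> k ∈ w -> forall k', k' ∈ w -> IsSucc k' k -> k' ∈ T) -> m ∈ T.

(** By induction on [m].  In the step from [k] to its successor [k'], if [n] is
    reached from [k] and differs from [k], it is reached from [k']: adjoin [k]
    to a set closed under successor that contains [k']. *)
Lemma Reach_total w : IsOmega w ->
  forall n m, n ∈ w -> m ∈ w -> Reach w n m \/ Reach w m n.
Proof.
  intros Hw n m Hn; revert m; apply omega_induction; auto.
  - unfold Reach, IsSucc, iff; def.
  - intros e He Ee; right; intros T HT HS.
    revert n Hn; apply omega_induction; auto.
    + def.
    + intros e' _ Ee'; replace e' with e; auto.
      apply extensionality; intros z; split; intros Hz; exfalso; firstorder.
    + intros n m Hn Hm HS' HnT; eauto.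
  - intros k k' Hk Hk' Hs [H|H].
    + left; intros T HT HS; apply (HS k); auto.
    + destruct (classic (n = k)) as [->|Hnk];
        [left; intros T HT HS; apply (HS k); auto|].
      right; intros T HT HS.
      destruct (separation (fun x => x = k \/ x ∈ T)) with (a := w) as [T' HT']; [def|].
      assert (K : n ∈ T').
      { apply H; [apply HT'; auto|].
        intros i Hi Hiw j Hj Hji; apply HT' in Hi; apply HT'; split; auto; right.
        destruct Hi as [_ [->|Hi]]; [|eauto].
        replace j with k'; auto.
        apply extensionality; intros z; rewrite (Hs z), (Hji z); tauto. }
      apply HT' in K; tauto.
Qed.

(** Dependent choice with the natural numbers eliminated: only the range [Z] of
    the sequence is kept.  The order in which its elements were chosen survives
    as the comparability of any two of them in every preorder that contains
    [S]. *)
Theorem dc_chain (dc : DependentChoice) A S :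
  Nonempty A -> IsRel S A A ->
  (forall x, x ∈ A -> exists y, y ∈ A /\ opair x y ∈ S) ->
  exists Z, Subset Z A /\ Nonempty Z /\
    (forall x, x ∈ Z -> exists y, y ∈ Z /\ opair x y ∈ S) /\
    forall Q : M -> M -> Prop, Def (fun r => Q (r 0) (r 1)) ->
      (forall x, x ∈ A -> Q x x) ->
      (forall x y z, y ∈ A -> Q x y -> Q y z -> Q x z) ->
      (forall x y, opair x y ∈ S -> Q x y) ->
      forall x y, x ∈ Z -> y ∈ Z -> Q x y \/ Q y x.
Proof.
  intros HA HS Ht; destruct omega_exists as [w Hw].
  destruct (dc A S HA HS Ht w Hw) as [a [Ha Hstep]].
  assert (Hstep' : forall n m x y, m ∈ w -> IsSucc m n -> opair n x ∈ a ->
    opair m y ∈ a -> opair x y ∈ S).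
  { intros n m x y Hm Hs Hx Hy.
    destruct (IsRel_in _ _ _ _ _ (proj1 Ha) Hx), (IsRel_in _ _ _ _ _ (proj1 Ha) Hy).
    apply (Hstep n) with (m := m); auto. }
  destruct (separation (fun x => exists n, n ∈ w /\ opair n x ∈ a))
    with (a := A) as [Z HZ]; [def|].
  exists Z; split; [intros x Hx; apply HZ, Hx|]; split; [|split].
  - destruct Hw as [[[e [He _]] _] _]; destruct (IsFun_total _ _ _ e Ha He) as [x [Hx Hex]].
    exists x; apply HZ; eauto.
  - intros x Hx; apply HZ in Hx; destruct Hx as [HxA [n [Hn Hnx]]].
    destruct (proj2 (proj1 Hw) n Hn) as [m [Hm Hmn]].
    destruct (IsFun_total _ _ _ m Ha Hm) as [y [Hy Hmy]].
    exists y; split; [apply HZ; eauto | apply (Hstep' n m); auto].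
  - intros Q HQ Qrefl Qtrans QS.
    assert (K : forall n m x y, m ∈ w -> Reach w n m ->
      opair n x ∈ a -> opair m y ∈ a -> Q x y).
    { intros n m x y Hm HR Hx Hy.
      destruct (separation (fun k => forall z, opair k z ∈ a -> Q x z))
        with (a := w) as [T HT]; [def|].
      assert (HmT : m ∈ T); [|apply HT in HmT; destruct HmT as [_ H]; apply H, Hy].
      destruct (IsRel_in _ _ _ _ _ (proj1 Ha) Hx) as [Hn HxA].
      apply HR.
      - apply HT; split; auto; intros z Hz.
        rewrite <- (IsFun_unique _ _ _ _ _ _ Ha Hx Hz); auto.
      - intros k Hk Hkw k' Hk' Hs; apply HT in Hk; apply HT; split; auto.
        intros z' Hz'; destruct (IsFun_total _ _ _ k Ha Hkw) as [z [HzA Hz]].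
        apply Qtrans with z; [exact HzA | apply Hk, Hz | apply QS; eauto]. }
    intros x y Hx Hy; apply HZ in Hx, Hy.
    destruct Hx as [_ [n [Hn Hnx]]], Hy as [_ [m [Hm Hmy]]].
    destruct (Reach_total w Hw n m Hn Hm); [left|right]; eauto.
Qed.

(** * Complete ordered fields *)

(** The value of a binary operation given as a set of pairs. *)
Definition ap op x y : M := epsilon (inhabits point) (Op op x y).

Lemma ap_spec op R x y : IsBinop op R -> x ∈ R -> y ∈ R ->
  ap op x y ∈ R /\ forall z, Op op x y z <-> z = ap op x y.
Proof.
  intros H Hx Hy; destruct (prod_exists R R) as [P HP].
  pose proof (H P HP) as Hf.
  assert (Hxy : opair x y ∈ P) by (apply HP; eauto 6).
  destruct (IsFun_total _ _ _ _ Hf Hxy) as [z [Hz Hxz]].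
  assert (K : Op op x y (ap op x y)) by (unfold ap; apply epsilon_spec; exists z; auto).
  split; [apply (IsRel_in _ _ _ _ _ (proj1 Hf) K)|].
  intros t; split; [|intros ->; auto].
  intros Ht; exact (IsFun_unique _ _ _ _ _ _ Hf Ht K).
Qed.

Section Reals.

Variables R add mul lt zero one : M.
Hypothesis HR : IsRealField R add mul lt zero one.

Notation "x ⊕ y" := (ap add x y) (at level 50, left associativity).
Notation "x ⊗ y" := (ap mul x y) (at level 40, left associativity).
Notation "x ≺ y" := (Lt lt x y) (at level 70).
Notation "x ≼ y" := (Le lt x y) (at level 70).

Lemma zero_in : zero ∈ R.
Proof. apply HR. Qed.
Lemma one_in : one ∈ R.
Proof. apply HR. Qed.
Lemma add_binop : IsBinop add R.
Proof. apply HR. Qed.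
Lemma mul_binop : IsBinop mul R.
Proof. apply HR. Qed.

Lemma plus_in x y : x ∈ R -> y ∈ R -> x ⊕ y ∈ R.
Proof. intros; apply (ap_spec add R); auto using add_binop. Qed.
Lemma times_in x y : x ∈ R -> y ∈ R -> x ⊗ y ∈ R.
Proof. intros; apply (ap_spec mul R); auto using mul_binop. Qed.
Lemma add_eq x y z : x ∈ R -> y ∈ R -> (Op add x y z <-> z = x ⊕ y).
Proof. intros; apply (ap_spec add R); auto using add_binop. Qed.
Lemma mul_eq x y z : x ∈ R -> y ∈ R -> (Op mul x y z <-> z = x ⊗ y).
Proof. intros; apply (ap_spec mul R); auto using mul_binop. Qed.

Hint Resolve zero_in one_in plus_in times_in : core.

Lemma plusC x y : x ∈ R -> y ∈ R -> x ⊕ y = y ⊕ x.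
Proof.
  intros Hx Hy; apply add_eq; auto.
  destruct HR as [HF _]; unfold IsField, OpComm in HF.
  apply HF; auto. apply add_eq; auto.
Qed.

Lemma timesC x y : x ∈ R -> y ∈ R -> x ⊗ y = y ⊗ x.
Proof.
  intros Hx Hy; apply mul_eq; auto.
  destruct HR as [HF _]; unfold IsField, OpComm in HF.
  apply HF; auto. apply mul_eq; auto.
Qed.

Lemma plusA x y z : x ∈ R -> y ∈ R -> z ∈ R -> x ⊕ y ⊕ z = x ⊕ (y ⊕ z).
Proof.
  intros Hx Hy Hz; apply add_eq; auto.
  destruct HR as [HF _]; unfold IsField, OpAssoc in HF.
  destruct HF as (_ & _ & _ & _ & _ & HA & _).
  apply (HA x Hx y Hy z Hz (x ⊕ y)); auto; apply add_eq; auto.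
Qed.

Lemma plus0 x : x ∈ R -> x ⊕ zero = x.
Proof. intros; symmetry; apply add_eq; auto; apply HR; auto. Qed.

Lemma times1 x : x ∈ R -> x ⊗ one = x.
Proof. intros; symmetry; apply mul_eq; auto; apply HR; auto. Qed.

Lemma opposite x : x ∈ R -> exists y, y ∈ R /\ x ⊕ y = zero.
Proof.
  intros Hx; destruct HR as [HF _].
  destruct HF as (_ & _ & _ & _ & _ & _ & _ & HN & _).
  destruct (HN x Hx) as [y [Hy H]]; exists y; split; auto; symmetry; apply add_eq; auto.
Qed.

Lemma inverse x : x ∈ R -> x <> zero -> exists y, y ∈ R /\ x ⊗ y = one.
Proof.
  intros Hx H0; destruct HR as [HF _].
  destruct HF as (_ & _ & _ & _ & _ & _ & _ & _ & _ & _ & _ & _ & HN & _).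
  destruct (HN x Hx H0) as [y [Hy H]]; exists y; split; auto; symmetry; apply mul_eq; auto.
Qed.

Lemma timesD x y z : x ∈ R -> y ∈ R -> z ∈ R -> x ⊗ (y ⊕ z) = x ⊗ y ⊕ x ⊗ z.
Proof.
  intros Hx Hy Hz; apply add_eq; auto; destruct HR as [HF _].
  destruct HF as (_ & _ & _ & _ & _ & _ & _ & _ & _ & _ & _ & _ & _ & HD).
  apply (HD x Hx y Hy z Hz (y ⊕ z)); auto; try (apply mul_eq; auto); apply add_eq; auto.
Qed.

Lemma lt_in x y : x ≺ y -> x ∈ R /\ y ∈ R.
Proof. apply IsRel_in, HR. Qed.

Lemma lt_irrefl x : ~ x ≺ x.
Proof. intros H; destruct (lt_in _ _ H); revert H; apply HR; auto. Qed.

Lemma lt_trans x y z : x ≺ y -> y ≺ z -> x ≺ z.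
Proof.
  intros H1 H2; destruct (lt_in _ _ H1), (lt_in _ _ H2).
  destruct HR as (_ & (_ & _ & Ht & _) & _).
  apply (Ht x) with (y := y); auto.
Qed.

Lemma le_lt_trans x y z : x ≼ y -> y ≺ z -> x ≺ z.
Proof. intros [H| ->]; eauto using lt_trans. Qed.

Lemma lt_le_trans x y z : x ≺ y -> y ≼ z -> x ≺ z.
Proof. intros H [K|<-]; eauto using lt_trans. Qed.

Lemma le_trans x y z : x ≼ y -> y ≼ z -> x ≼ z.
Proof. intros [H| ->]; auto; intros H'; left; eauto using lt_le_trans. Qed.

Lemma le_refl x : x ≼ x.
Proof. right; auto. Qed.

Lemma le_not_lt x y : x ≼ y -> ~ y ≺ x.
Proof. intros H K; apply (lt_irrefl x); eauto using le_lt_trans. Qed.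

Lemma le_or_lt x y : x ∈ R -> y ∈ R -> x ≼ y \/ y ≺ x.
Proof.
  intros Hx Hy; destruct HR as (_ & (_ & _ & _ & Ht) & _).
  destruct (Ht x Hx y Hy) as [H|[H|H]]; unfold Le; auto.
Qed.

Lemma le_antisym x y : x ≼ y -> y ≼ x -> x = y.
Proof. intros [H|H] K; auto; destruct (le_not_lt _ _ K H). Qed.

Lemma lt_plus_r x y z : z ∈ R -> x ≺ y -> x ⊕ z ≺ y ⊕ z.
Proof.
  intros Hz H; destruct (lt_in _ _ H) as [Hx Hy].
  destruct HR as (_ & _ & Ha & _).
  apply (Ha x Hx y Hy z Hz); auto; apply add_eq; auto.
Qed.

Lemma lt_plus_l x y z : z ∈ R -> x ≺ y -> z ⊕ x ≺ z ⊕ y.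
Proof.
  intros Hz H; destruct (lt_in _ _ H).
  rewrite (plusC z x), (plusC z y) by auto; apply lt_plus_r; auto.
Qed.

Lemma lt_plus2 x y : x ≺ y -> x ⊕ x ≺ y ⊕ y.
Proof.
  intros H; destruct (lt_in _ _ H).
  apply lt_trans with (x ⊕ y); [apply lt_plus_l | apply lt_plus_r]; auto.
Qed.

Lemma le_plus2 x y : x ≼ y -> x ⊕ x ≼ y ⊕ y.
Proof. intros [H| ->]; [left; apply lt_plus2; auto | apply le_refl]. Qed.

Lemma lt_plus_pos x d : x ∈ R -> zero ≺ d -> x ≺ x ⊕ d.
Proof. intros Hx H; rewrite <- (plus0 x) at 1 by auto; apply lt_plus_l; auto. Qed.

Lemma plus_cancel x y z : x ∈ R -> y ∈ R -> z ∈ R -> x ⊕ z = y ⊕ z -> x = y.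
Proof.
  intros Hx Hy Hz H; destruct (opposite z Hz) as [n [Hn E]].
  rewrite <- (plus0 x), <- (plus0 y), <- E, <- !plusA, H by auto; auto.
Qed.

Lemma times0 x : x ∈ R -> x ⊗ zero = zero.
Proof.
  intros Hx; apply (plus_cancel _ _ (x ⊗ zero)); auto.
  rewrite <- timesD, plus0, (plusC zero), plus0 by auto; auto.
Qed.

Lemma zero_lt_one : zero ≺ one.
Proof.
  (* if 1 < 0 then 0 < -1, and 1 = (-1)(-1) is positive after all *)
  destruct (le_or_lt one zero) as [[H|H]|H]; auto.
  - destruct (opposite one) as [n [Hn E]]; auto.
    assert (Pn : zero ≺ n).
    { pose proof (lt_plus_r one zero n Hn H) as K.
      rewrite E, plusC, plus0 in K by auto; exact K. }
    assert (E1 : n ⊗ n = one).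
    { apply (plus_cancel _ _ n); auto.
      rewrite <- (times1 n) at 3 by auto.
      rewrite <- timesD, (plusC n one), E, times0 by auto; auto. }
    destruct HR as (_ & _ & _ & Hm & _).
    apply (Hm n Hn n Hn); auto. apply mul_eq; auto.
  - exfalso; destruct HR as [(_ & _ & H0 & _) _]; auto.
Qed.

Lemma half_exists d : zero ≺ d -> exists h, zero ≺ h /\ h ⊕ h = d.
Proof.
  intros Hd; destruct (lt_in _ _ Hd) as [_ HdR].
  destruct (inverse (one ⊕ one)) as [k [Hk E]]; auto.
  { intros E; apply (lt_irrefl zero); rewrite <- E at 2.
    eapply lt_trans; [apply zero_lt_one | apply lt_plus_pos; auto using zero_lt_one]. }
  assert (Eh : d ⊗ k ⊕ d ⊗ k = d).
  { rewrite <- timesD by auto.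
    replace (k ⊕ k) with one; [apply times1; auto|].
    rewrite <- E, timesC, timesD, times1 by auto; auto. }
  exists (d ⊗ k); split; auto.
  destruct (le_or_lt (d ⊗ k) zero) as [H|H]; auto.
  exfalso; apply (le_not_lt d zero); auto.
  rewrite <- Eh, <- (plus0 zero) by auto; apply le_plus2; auto.
Qed.

Lemma difference_exists a b : a ≺ b -> exists e, zero ≺ e /\ a ⊕ e = b.
Proof.
  intros H; destruct (lt_in _ _ H) as [Ha Hb]; destruct (opposite a Ha) as [n [Hn E]].
  exists (b ⊕ n); split.
  - rewrite <- E; apply lt_plus_r; auto.
  - rewrite plusC, plusA, (plusC n), E, plus0 by auto; auto.
Qed.

Lemma supremum E : Subset E R -> Nonempty E -> (exists u, u ∈ R /\ UpperBound lt E u) ->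
  exists s, s ∈ R /\ UpperBound lt E s /\ forall u, u ∈ R -> UpperBound lt E u -> s ≼ u.
Proof. apply HR. Qed.

Lemma lt_supremum E s x : Subset E R -> x ≺ s ->
  (forall u, u ∈ R -> UpperBound lt E u -> s ≼ u) -> exists y, y ∈ E /\ x ≺ y.
Proof.
  intros HE Hx Hs; apply NNPP; intros N; apply (le_not_lt s x); auto.
  apply Hs; [apply (lt_in _ _ Hx)|]; intros y Hy.
  destruct (le_or_lt y x) as [H|H]; auto; [apply (lt_in _ _ Hx)|].
  exfalso; eauto.
Qed.

(** The Archimedean principle, without natural numbers: if [s] were the
    supremum of [E], some point of [E] above [s - d] would be shifted beyond
    [s]. *)
Lemma no_bounded_shift E d : zero ≺ d -> Subset E R -> Nonempty E ->
  (exists u, u ∈ R /\ UpperBound lt E u) -> ~ forall x, x ∈ E -> x ⊕ d ∈ E.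
Proof.
  intros Hd HE H0 Hu Hs; destruct (supremum E HE H0 Hu) as [s [HsR [Hs1 Hs2]]].
  destruct (lt_in _ _ Hd) as [_ HdR]; destruct (opposite d HdR) as [n [Hn En]].
  assert (K : (s ⊕ n) ⊕ d = s) by (rewrite plusA, (plusC n), En, plus0; auto).
  destruct (lt_supremum E s (s ⊕ n)) as [y [Hy Hlt]]; auto.
  { rewrite <- K at 2; apply lt_plus_pos; auto. }
  apply (le_not_lt (y ⊕ d) s); [apply Hs1, Hs, Hy|].
  rewrite <- K at 1; apply lt_plus_r; auto.
Qed.

(** If [s] were the supremum of [E], then [s > 0], and doubling a point of [E]
    above [s/2] would exceed [s]. *)
Lemma no_bounded_doubling E x : zero ≺ x -> x ∈ E -> Subset E R ->
  (exists u, u ∈ R /\ UpperBound lt E u) -> ~ forall x, x ∈ E -> x ⊕ x ∈ E.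
Proof.
  intros Hx HxE HE Hu Hs.
  destruct (supremum E HE (ex_intro _ x HxE) Hu) as [s [HsR [Hs1 Hs2]]].
  destruct (half_exists s) as [h [Hh Eh]].
  { apply lt_le_trans with x; auto. }
  destruct (lt_supremum E s h) as [y [Hy Hlt]]; auto.
  { rewrite <- Eh; apply lt_plus_pos; auto; apply (lt_in _ _ Hh). }
  apply (le_not_lt (y ⊕ y) s); [apply Hs1, Hs, Hy|].
  rewrite <- Eh; apply lt_plus2; auto.
Qed.

(** * Sweeping the unit interval *)

(** A pair (d, q) is a step size with a current position.  The next pair
    moves [q] by [d], or, when this reaches 1, returns to 0 and halves [d]. *)
Definition Sweep W :=
  (forall d q, opair d q ∈ W -> zero ≺ d /\ zero ≼ q /\ q ≺ one) /\
  forall d q, opair d q ∈ W ->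
    opair d (q ⊕ d) ∈ W \/
    (one ≼ q ⊕ d /\ exists d', d' ⊕ d' = d /\ opair d' zero ∈ W).

(** A condition that persists along the steps cuts a sweep out of a sweep.
    Applying [sweep_returns] to it gives a return at which the condition holds;
    this replaces speaking of later stages. *)
Lemma sweep_restrict W (P : M -> M -> Prop) :
  Def (fun r => P (r 0) (r 1)) -> Sweep W ->
  (forall d q, opair d q ∈ W -> P d q ->
    (opair d (q ⊕ d) ∈ W -> P d (q ⊕ d)) /\
    (forall d', zero ≺ d' -> one ≼ q ⊕ d -> d' ⊕ d' = d -> P d' zero)) ->
  exists T, Sweep T /\ forall d q, opair d q ∈ T <-> opair d q ∈ W /\ P d q.
Proof.
  intros HP [HW1 HW2] H.
  destruct (rel_separation (fun d q => opair d q ∈ W /\ P d q) R R) as [T [_ HT]]; [def|].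
  assert (HT' : forall d q, opair d q ∈ T <-> opair d q ∈ W /\ P d q).
  { intros d q; rewrite HT; split; [tauto|]; intros K; split; [|split]; auto;
      destruct (HW1 d q) as [H1 [_ H2]]; try tauto;
      [apply (lt_in _ _ H1) | apply (lt_in _ _ H2)]. }
  exists T; split; auto; split.
  - intros d q K; apply HT' in K; apply HW1; tauto.
  - intros d q K; apply HT' in K; destruct K as [K1 K2], (H d q K1 K2) as [L1 L2].
    destruct (HW2 d q K1) as [K|[K [d' [E K']]]].
    + left; apply HT'; auto.
    + right; split; auto; exists d'; split; auto; apply HT'; split; auto.
      apply L2; auto; apply (HW1 d' zero K').
Qed.

(** Without a return the positions reached with step [d0] would form a
    bounded set closed under adding [d0]. *)
Lemma sweep_returns W d0 q0 : Sweep W -> opair d0 q0 ∈ W ->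
  exists d q d', opair d q ∈ W /\ one ≼ q ⊕ d /\ d' ⊕ d' = d /\ opair d' zero ∈ W.
Proof.
  intros [HW1 HW2] H0; apply NNPP; intros N.
  destruct (separation (fun q => opair d0 q ∈ W)) with (a := R) as [E HE]; [def|].
  destruct (HW1 _ _ H0) as [Hd0 [_ Hq0]].
  apply (no_bounded_shift E d0); auto.
  - intros q Hq; apply HE, Hq.
  - exists q0; apply HE; split; auto; apply (lt_in _ _ Hq0).
  - exists one; split; auto; intros q Hq; left; apply HE in Hq.
    apply (HW1 d0 q); tauto.
  - intros q Hq; apply HE in Hq; destruct Hq as [HqR Hq].
    destruct (lt_in _ _ Hd0); apply HE; split; auto.
    destruct (HW2 _ _ Hq) as [K|[K [d' [E' K']]]]; auto.
    exfalso; apply N; exists d0, q, d'; auto.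
Qed.

(** Each step size is halved later, so the lower bounds of all the step sizes
    are closed under doubling and none of them is positive. *)
Lemma sweep_small W e d0 q0 : Sweep W -> opair d0 q0 ∈ W -> zero ≺ e ->
  exists d q, opair d q ∈ W /\ d ≺ e.
Proof.
  intros HW H0 He; apply NNPP; intros N.
  destruct (separation (fun x => forall d q, opair d q ∈ W -> opair x d ∈ lt \/ x = d))
    with (a := R) as [L HL]; [def|].
  destruct (lt_in _ _ He) as [_ HeR].
  apply (no_bounded_doubling L e); auto.
  - apply HL; split; auto; intros d q Hdq.
    destruct (le_or_lt e d) as [K|K]; auto.
    + apply (lt_in _ _ (proj1 (proj1 HW _ _ Hdq))).
    + exfalso; eauto.
  - intros x Hx; apply HL, Hx.
  - exists d0; split; [apply (lt_in _ _ (proj1 (proj1 HW _ _ H0)))|].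
    intros x Hx; apply HL in Hx; eapply (proj2 Hx); eauto.
  - intros x Hx; apply HL in Hx; destruct Hx as [HxR Hx]; apply HL; split; auto.
    intros d q Hdq.
    destruct (sweep_restrict W (fun d1 _ => opair d1 d ∈ lt \/ d1 = d)) as [T [HT1 HT2]];
      auto; [def| |].
    { intros d1 q1 H1 K; split; auto; intros d' Hd' _ <-.
      left; apply lt_le_trans with (d' ⊕ d'); auto.
      apply lt_plus_pos; auto; apply (lt_in _ _ Hd'). }
    assert (Hd : opair d q ∈ T) by (apply HT2; auto).
    destruct (sweep_returns T d q HT1 Hd) as [d1 [q1 [d' [K1 [_ [<- K2]]]]]].
    apply HT2 in K1, K2; destruct K1 as [_ K1], K2 as [K2 _].
    apply le_trans with (d' ⊕ d'); auto.
    apply le_plus2; eapply Hx; eauto.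
Qed.

(** Once the step is below the length of an interval, a sweep starting at 0
    cannot jump over it. *)
Lemma sweep_dense W d0 q0 a b : Sweep W -> opair d0 q0 ∈ W ->
  zero ≼ a -> a ≺ b -> b ≼ one -> exists d q, opair d q ∈ W /\ a ≺ q /\ q ≺ b.
Proof.
  intros HW H0 Ha Hab Hb; apply NNPP; intros N.
  destruct (lt_in _ _ Hab) as [HaR HbR].
  destruct (difference_exists a b Hab) as [e [He Eb]].
  destruct (sweep_small W e d0 q0 HW H0 He) as [d [q [Hdq Hde]]].
  destruct (sweep_restrict W (fun d _ => opair d e ∈ lt)) as [T1 [HT1 HT1']]; auto; [def| |].
  { intros d1 q1 _ K; split; auto; intros d' Hd' _ <-.
    apply lt_trans with (d' ⊕ d'); auto.
    apply lt_plus_pos; auto; apply (lt_in _ _ Hd'). }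
  assert (K1 : opair d q ∈ T1) by (apply HT1'; auto).
  destruct (sweep_returns T1 d q HT1 K1) as [_ [_ [d1 [_ [_ [_ K2]]]]]].
  apply HT1' in K2; destruct K2 as [K2 K3].
  assert (Hstep : forall d q, opair d e ∈ lt -> opair q a ∈ lt \/ q = a -> q ⊕ d ≺ b).
  { intros d2 q2 L1 L2; destruct (lt_in _ _ L1) as [Hd2 HeR]; rewrite <- Eb.
    assert (q2 ∈ R) by (destruct L2 as [L2| ->]; auto; apply (lt_in _ _ L2)).
    apply lt_le_trans with (q2 ⊕ e); [apply lt_plus_l; auto|].
    destruct L2 as [L2| ->]; [left; apply lt_plus_r; auto | apply le_refl]. }
  destruct (sweep_restrict W (fun d q => opair d e ∈ lt /\ (opair q a ∈ lt \/ q = a)))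
    as [T2 [HT2 HT2']]; auto; [def| |].
  { intros d2 q2 L [L1 L2]; specialize (Hstep d2 q2 L1 L2); split.
    - intros L3; split; auto.
      destruct (le_or_lt (q2 ⊕ d2) a) as [L4|L4]; auto; [apply (lt_in _ _ Hstep)|].
      exfalso; apply N; eauto.
    - intros d' _ L3; exfalso; apply (le_not_lt b (q2 ⊕ d2)); auto.
      apply le_trans with one; auto. }
  assert (K4 : opair d1 zero ∈ T2) by (apply HT2'; auto).
  destruct (sweep_returns T2 d1 zero HT2 K4) as [d2 [q2 [d' [L [L' _]]]]].
  apply HT2' in L; destruct L as [_ [L1 L2]].
  apply (le_not_lt b (q2 ⊕ d2)); auto.
  apply le_trans with one; auto.
Qed.

(** * Scales of open sets *)

Variables X mu : M.
Hypothesis mu_topology : GenTopology X mu.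
Hypothesis X_normal : Normal X mu.

(** [P] is the union of its open subsets.  Continuity can therefore be checked
    one point at a time, although open sets need not be closed under finite
    intersections. *)
Lemma open_local P : Subset P X ->
  (forall x, x ∈ P -> exists O, O ∈ mu /\ x ∈ O /\ Subset O P) -> P ∈ mu.
Proof.
  intros HP H.
  destruct (separation (fun O => forall z, z ∈ O -> z ∈ P)) with (a := mu) as [F HF]; [def|].
  apply (proj2 mu_topology) with F.
  - intros O HO; apply HF, HO.
  - intros x; split.
    + intros Hx; destruct (H x Hx) as [O [HO [HxO HOP]]]; exists O; split; auto.
      apply HF; auto.
    + intros [O [HO Hx]]; apply HF in HO; apply HO, Hx.
Qed.

Lemma open_subset O : O ∈ mu -> Subset O X.
Proof. apply mu_topology. Qed.

Lemma diff_exists A : exists C, IsDiff C X A.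
Proof.
  destruct (separation (fun x => ~ x ∈ A)) with (a := X) as [C HC]; [def|].
  exists C; exact HC.
Qed.

Lemma closed_diff O C : O ∈ mu -> IsDiff C X O -> ClosedIn X mu C.
Proof.
  intros HO HC; split; [intros x Hx; apply HC, Hx|].
  intros D HD; replace D with O; auto.
  apply extensionality; intros z; rewrite (HD z), (HC z).
  split; [|tauto]; intros Hz; split; [apply (open_subset O HO z Hz) | tauto].
Qed.

(** Some closed set, the complement of [O], lies between [U] and [V]. *)
Definition Below U V :=
  exists O, O ∈ mu /\ Disjoint U O /\ forall x, x ∈ X -> x ∈ V \/ x ∈ O.

Lemma Below_subset U V : Subset U X -> Below U V -> Subset U V.
Proof.
  intros HU [O [_ [H1 H2]]] x Hx; destruct (H2 x (HU x Hx)) as [|K]; auto.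
  exfalso; apply H1; eauto.
Qed.

Lemma Below_weaken U U' V V' :
  Subset U' U -> Below U V -> Subset V V' -> Below U' V'.
Proof.
  intros HU [O [HO [H1 H2]]] HV; exists O; split; [|split]; auto.
  - intros [z [Hz Hz']]; apply H1; eauto.
  - intros x Hx; destruct (H2 x Hx); auto.
Qed.

(** Normality separates the closed set between [U] and [V] from the complement
    of [V]. *)
Lemma Below_interpolate U V : U ∈ mu -> V ∈ mu -> Below U V ->
  exists W, W ∈ mu /\ Below U W /\ Below W V.
Proof.
  intros HU HV [O [HO [H1 H2]]].
  destruct (diff_exists O) as [C HC], (diff_exists V) as [D HD].
  destruct (X_normal C D) as [W [HW [O' [HO' [H3 [H4 H5]]]]]].
  - apply (closed_diff O); auto.
  - apply (closed_diff V); auto.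
  - intros [z [Hz Hz']]; apply HC in Hz; apply HD in Hz'.
    destruct (H2 z); tauto.
  - exists W; split; auto; split.
    + exists O; split; [|split]; auto; intros x Hx.
      destruct (classic (x ∈ O)); auto; left; apply H4, HC; auto.
    + exists O'; split; [|split]; auto; intros x Hx.
      destruct (classic (x ∈ V)); auto; right; apply H5, HD; auto.
Qed.

Variables U0 U1 : M.
Hypothesis U0_open : U0 ∈ mu.
Hypothesis U1_open : U1 ∈ mu.
Hypothesis U0_below_U1 : Below U0 U1.

Definition Dom F d := exists U, opair d U ∈ F.

Definition Scale F :=
  IsRel F R mu /\
  (forall d U, opair d U ∈ F -> zero ≼ d /\ d ≼ one) /\
  (forall d U e V, opair d U ∈ F -> opair e V ∈ F -> d ≺ e -> Below U V) /\
  opair zero U0 ∈ F /\ opair one U1 ∈ F.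

(** What is used of the finiteness of a family: at most one set for each index,
    and nearest indices on both sides of every missing one.  Unlike finiteness,
    this is preserved by an insertion for reasons of order alone. *)
Definition Discrete F :=
  (forall d U V, opair d U ∈ F -> opair d V ∈ F -> U = V) /\
  (forall x, x ∈ R -> zero ≼ x -> x ≼ one -> Dom F x \/
     exists d e, Dom F d /\ Dom F e /\ d ≺ x /\ x ≺ e /\
       forall g, Dom F g -> g ≼ d \/ e ≼ g).

Lemma zero_le_one : zero ≼ one.
Proof. left; apply zero_lt_one. Qed.

Hint Resolve le_refl zero_le_one : core.

Lemma initial_scale : exists F, Scale F /\ Discrete F.
Proof.
  exists (upair (opair zero U0) (opair one U1)).
  assert (H : forall d U, opair d U ∈ upair (opair zero U0) (opair one U1) <->
    d = zero /\ U = U0 \/ d = one /\ U = U1).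
  { intros d U; rewrite in_upair; split.
    - intros [E|E]; apply opair_inj in E; auto.
    - intros [[-> ->]|[-> ->]]; auto. }
  assert (Hneq : zero <> one) by apply HR.
  split; [split; [|split; [|split; [|split]]] | split].
  - intros p Hp; apply in_upair in Hp; destruct Hp as [->| ->]; eauto 10.
  - intros d U Hd; apply H in Hd; destruct Hd as [[-> _]|[-> _]]; auto.
  - intros d U e V Hd He Hde; apply H in Hd, He.
    destruct Hd as [[-> ->]|[-> ->]], He as [[-> ->]|[-> ->]]; auto;
      exfalso; try apply (lt_irrefl _ Hde); apply (le_not_lt _ _ zero_le_one Hde).
  - apply in_upair; auto.
  - apply in_upair; auto.
  - intros d U V Hd He; apply H in Hd, He.
    destruct Hd as [[-> ->]|[-> ->]], He as [[E ->]|[E ->]]; congruence.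
  - intros x Hx [H0|<-] H1; [|left; exists U0; apply H; auto].
    destruct H1 as [H1| ->]; [|left; exists U1; apply H; auto].
    right; exists zero, one; split; [exists U0; apply H; auto|].
    split; [exists U1; apply H; auto|]; split; [|split]; auto.
    intros g [U Hg]; apply H in Hg; destruct Hg as [[-> _]|[-> _]]; auto.
Qed.

(** The new set is interpolated between those at the two neighbouring indices,
    and the other members compare with it through these two. *)
Lemma scale_insert F x : Scale F -> Discrete F -> x ∈ R -> zero ≼ x -> x ≼ one ->
  exists F', Scale F' /\ Discrete F' /\ Subset F F' /\ Dom F' x.
Proof.
  intros HS HD Hx H0 H1.
  pose proof HS as [S1 [S2 [S3 [S4 S5]]]]; pose proof HD as [D1 D2].
  destruct (D2 x Hx H0 H1) as [Hdom|[d [e [[U Hd] [[V He] [Hdx [Hxe Hg]]]]]]].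
  { exists F; split; [|split; [|split]]; auto; intros p Hp; auto. }
  destruct (IsRel_in _ _ _ _ _ S1 Hd) as [HdR HU], (IsRel_in _ _ _ _ _ S1 He) as [HeR HV].
  destruct (Below_interpolate U V) as [W [HW [HUW HWV]]]; auto.
  { apply (S3 d U e V); auto; eauto using lt_trans. }
  destruct (union2_exists F (upair (opair x W) (opair x W))) as [F' HF'].
  assert (H : forall a Y, opair a Y ∈ F' <-> opair a Y ∈ F \/ a = x /\ Y = W).
  { intros a Y; rewrite HF', in_upair; split; intros [K|K]; auto.
    - right; apply opair_inj; tauto.
    - destruct K as [-> ->]; auto. }
  assert (Hlow : forall a Y, opair a Y ∈ F -> a ≼ d -> Below Y W).
  { intros a Y Ha [Had| ->].
    - apply Below_weaken with U W; auto; [|intros z Hz; auto].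
      apply Below_subset; [apply open_subset, (IsRel_in _ _ _ _ _ S1 Ha) | eauto].
    - replace Y with U; eauto. }
  assert (Hhigh : forall a Y, opair a Y ∈ F -> e ≼ a -> Below W Y).
  { intros a Y Ha [Hea| <-].
    - apply Below_weaken with W V; auto; [intros z Hz; auto|].
      apply Below_subset; [apply open_subset; auto | eauto].
    - replace Y with V; eauto. }
  assert (Hnew : forall Y, ~ opair x Y ∈ F).
  { intros Y HY; destruct (Hg x (ex_intro _ Y HY)) as [K|K];
      [apply (le_not_lt _ _ K Hdx) | apply (le_not_lt _ _ K Hxe)]. }
  exists F'; split; [split; [|split; [|split; [|split]]] | split; [split|split]].
  - intros p Hp; apply HF' in Hp; destruct Hp as [Hp|Hp]; auto.
    apply in_upair in Hp; exists x; split; auto; exists W; split; auto; tauto.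
  - intros a Y Ha; apply H in Ha; destruct Ha as [Ha|[-> _]]; auto; eapply S2; eauto.
  - intros a Y b Z Ha Hb Hab; apply H in Ha, Hb.
    destruct Ha as [Ha|[-> ->]], Hb as [Hb|[-> ->]].
    + eauto.
    + destruct (Hg a (ex_intro _ Y Ha)) as [K|K]; [eauto|].
      exfalso; apply (le_not_lt e a); auto; eauto using lt_trans.
    + destruct (Hg b (ex_intro _ Z Hb)) as [K|K]; [|eauto].
      exfalso; apply (le_not_lt b d); auto; eauto using lt_trans.
    + destruct (lt_irrefl _ Hab).
  - apply H; auto.
  - apply H; auto.
  - intros a Y Z Ha Hb; apply H in Ha, Hb.
    destruct Ha as [Ha|[-> ->]], Hb as [Hb|[E ->]]; subst; eauto;
      exfalso; eapply Hnew; eauto.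
  - assert (Hdom : forall a, Dom F' a <-> Dom F a \/ a = x).
    { intros a; split.
      - intros [Y Ha]; apply H in Ha; destruct Ha as [Ha|[-> _]]; auto; left; exists Y; auto.
      - intros [[Y Ha]| ->]; [exists Y | exists W]; apply H; auto. }
    intros y Hy Hy0 Hy1.
    destruct (D2 y Hy Hy0 Hy1) as [K|[a [b [Ka [Kb [Hay [Hyb Hab]]]]]]].
    { left; apply Hdom; auto. }
    destruct (le_or_lt x y) as [[Hxy| ->]|Hyx]; auto.
    + right; destruct (le_or_lt x a) as [Hxa|Hax]; [auto| apply (lt_in _ _ Hay) | |].
      * exists a, b; rewrite !Hdom; repeat split; auto.
        intros g Hg'; apply Hdom in Hg'; destruct Hg' as [Hg'| ->]; auto.
      * exists x, b; rewrite !Hdom; repeat split; auto.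
        intros g Hg'; apply Hdom in Hg'; destruct Hg' as [Hg'| ->]; auto.
        destruct (Hab g Hg') as [K|K]; auto; left; left; eauto using le_lt_trans.
    + left; apply Hdom; auto.
    + right; destruct (le_or_lt b x) as [Hbx|Hxb]; [apply (lt_in _ _ Hyb) | auto | |].
      * exists a, b; rewrite !Hdom; repeat split; auto.
        intros g Hg'; apply Hdom in Hg'; destruct Hg' as [Hg'| ->]; auto.
      * exists a, x; rewrite !Hdom; repeat split; auto.
        intros g Hg'; apply Hdom in Hg'; destruct Hg' as [Hg'| ->]; auto.
        destruct (Hab g Hg') as [K|K]; auto; right; left; eauto using lt_le_trans.
  - intros p Hp; apply HF'; auto.
  - exists W; apply H; auto.
Qed.

(** * A dense scale from dependent choice *)

Definition State t F d q := t = opair (opair F d) q.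

Definition Good F d q :=
  Scale F /\ Discrete F /\ zero ≺ d /\ zero ≼ q /\ q ≺ one /\ Dom F q.

(** The addition enters through its graph, which is definable in the model. *)
Definition Next F d q F' d' q' :=
  (forall p, p ∈ F -> p ∈ F') /\
  (Op add q d q' /\ d' = d \/
   exists s, Op add q d s /\ one ≼ s /\ q' = zero /\ Op add d' d' d).

Lemma State_inj t F d q F' d' q' :
  State t F d q -> State t F' d' q' -> F = F' /\ d = d' /\ q = q'.
Proof.
  unfold State; intros -> E; apply opair_inj in E; destruct E as [E ->].
  apply opair_inj in E; destruct E; auto.
Qed.

Lemma next_exists F d q : Good F d q ->
  exists F' d' q', Good F' d' q' /\ Next F d q F' d' q'.
Proof.
  intros (HS & HD & Hd & Hq0 & Hq1 & Hdom).
  destruct (lt_in _ _ Hd) as [_ HdR], (lt_in _ _ Hq1) as [HqR _].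
  destruct (le_or_lt one (q ⊕ d)) as [K|K]; auto.
  - destruct (half_exists d Hd) as [h [Hh Eh]].
    destruct (lt_in _ _ Hh) as [_ HhR].
    exists F, h, zero; split; [|split; auto].
    + split; [|split; [|split; [|split; [|split]]]]; auto using zero_lt_one.
      exists U0; apply HS.
    + right; exists (q ⊕ d); split; [|split; [|split]]; auto; apply add_eq; auto.
  - assert (Hq : q ≺ q ⊕ d) by (apply lt_plus_pos; auto).
    destruct (scale_insert F (q ⊕ d)) as [F' [HS' [HD' [HFF Hdom']]]]; auto.
    { left; eauto using le_lt_trans. }
    { left; auto. }
    exists F', d, (q ⊕ d); split; [|split; auto].
    + split; [|split; [|split; [|split; [|split]]]]; auto.
      left; eauto using le_lt_trans.
    + left; split; auto; apply add_eq; auto.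
Qed.

Definition DenseScale G :=
  Scale G /\ forall a b, zero ≼ a -> a ≺ b -> b ≼ one ->
    exists d U, opair d U ∈ G /\ a ≺ d /\ d ≺ b.

Lemma Scale_Def : Def (fun r => Scale (r 0)).
Proof.
  unfold Scale, IsRel, Below, Disjoint, Le, Lt; def.
Qed.

Lemma Discrete_Def : Def (fun r => Discrete (r 0)).
Proof. unfold Discrete, Dom, Le, Lt; def. Qed.

(** The union [G] of the scales in the chain [Z] of states is a scale because
    any two of its members lie in one of them; the steps and positions in [Z]
    form a sweep, and every position is an index of [G]. *)
Lemma dense_scale_exists : DependentChoice -> exists G, DenseScale G.
Proof.
  intros dc.
  pose proof Scale_Def as DS; pose proof Discrete_Def as DD.
  destruct (prod_exists R mu) as [Rmu HRmu].
  destruct (powerset_exists Rmu) as [PF HPF].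
  destruct (prod_exists PF R) as [P1 HP1], (prod_exists P1 R) as [P2 HP2].
  destruct (separation (fun t => exists F d q, State t F d q /\ Good F d q))
    with (a := P2) as [A HA]; [unfold State, Good, Dom, Le, Lt; def|].
  assert (HA' : forall t, t ∈ A <-> exists F d q, State t F d q /\ Good F d q).
  { intros t; rewrite (HA t); split; [tauto|]; intros H; split; auto.
    destruct H as [F [d [q [Ht [HS [_ [Hd [_ [Hq _]]]]]]]]].
    apply HP2; exists (opair F d); split; [|exists q; split; auto; apply (lt_in _ _ Hq)].
    apply HP1; exists F; split; [|exists d; split; auto; apply (lt_in _ _ Hd)].
    apply HPF; intros p Hp; apply HRmu, (proj1 HS p Hp). }
  destruct (rel_separation (fun t t' => exists F d q F' d' q',
      State t F d q /\ State t' F' d' q' /\ Next F d q F' d' q') A A) as [S [HS HSin]].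
  { unfold State, Next, Op, Le, Lt; def. }
  destruct (dc_chain dc A S) as [Z [HZA [[t0 Ht0] [HZS HZQ]]]]; auto.
  { destruct initial_scale as [F [HF1 HF2]]; exists (opair (opair F one) zero).
    apply HA'; exists F, one, zero; split; [reflexivity|].
    split; [|split; [|split; [|split; [|split]]]]; auto using zero_lt_one.
    exists U0; apply HF1. }
  { intros t Ht; pose proof Ht as Ht'; apply HA' in Ht'.
    destruct Ht' as [F [d [q [Hst Hgood]]]].
    destruct (next_exists F d q Hgood) as [F' [d' [q' [Hgood' Hnext]]]].
    exists (opair (opair F' d') q').
    assert (Ht' : opair (opair F' d') q' ∈ A)
      by (apply HA'; exists F', d', q'; split; [reflexivity | auto]).
    split; auto; apply HSin; split; [|split]; auto.
    exists F, d, q, F', d', q'; split; [|split]; auto; reflexivity. }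
  assert (HZ : forall F d q, opair (opair F d) q ∈ Z -> Good F d q).
  { intros F d q H; apply HZA, HA' in H.
    destruct H as [F1 [d1 [q1 [H1 H2]]]].
    destruct (State_inj _ F d q F1 d1 q1 eq_refl H1) as [-> [-> ->]]; auto. }
  assert (Hex : forall t, t ∈ Z -> exists F d q, t = opair (opair F d) q).
  { intros t Ht; apply HZA, HA' in Ht; destruct Ht as [F [d [q [H _]]]]; eauto. }
  destruct (rel_separation (fun d U => exists F e q,
    opair (opair F e) q ∈ Z /\ opair d U ∈ F) R mu) as [G [HG HG']]; [def|].
  assert (HGin : forall F e q d U, opair (opair F e) q ∈ Z -> opair d U ∈ F ->
    opair d U ∈ G).
  { intros F e q d U H1 H2; apply HG'.
    destruct (IsRel_in _ _ _ _ _ (proj1 (proj1 (HZ _ _ _ H1))) H2); eauto 8. }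
  destruct (Hex t0 Ht0) as [F0 [d0 [q0 ->]]].
  destruct (HZ _ _ _ Ht0) as [[_ [_ [_ [HF0 HF1]]]] _].
  exists G; split; [split; [|split; [|split; [|split]]]|]; eauto.
  - intros d U H; apply HG' in H; destruct H as [_ [_ [F [e [q [H1 H2]]]]]].
    apply (HZ _ _ _ H1) in H2; auto.
  - intros d U e V HU HV Hde; apply HG' in HU, HV.
    destruct HU as [_ [_ [F [e1 [q1 [H1 H2]]]]]], HV as [_ [_ [F' [e2 [q2 [H3 H4]]]]]].
    destruct (HZQ (fun t t' => forall F d q F' d' q',
      State t F d q -> State t' F' d' q' -> forall p, p ∈ F -> p ∈ F'))
      with (x := opair (opair F e1) q1) (y := opair (opair F' e2) q2) as [K|K]; auto.
    + unfold State; def.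
    + intros t _ F1 d1 q3 F2 d2 q4 E1 E2.
      destruct (State_inj _ _ _ _ _ _ _ E1 E2) as [-> _]; auto.
    + intros t1 t2 t3 HA2 K1 K2 F1 d1 q3 F3 d3 q5 E1 E3.
      apply HA' in HA2; destruct HA2 as [F2 [d2 [q4 [E2 _]]]]; eauto 10.
    + intros t1 t2 K F1 d1 q3 F2 d2 q4 E1 E2; apply HSin in K.
      destruct K as [_ [_ [F3 [d3 [q5 [F4 [d4 [q6 [E3 [E4 [K _]]]]]]]]]]].
      destruct (State_inj _ _ _ _ _ _ _ E1 E3) as [-> _].
      destruct (State_inj _ _ _ _ _ _ _ E2 E4) as [-> _]; auto.
    + assert (H5 : opair d U ∈ F') by (eapply K; try reflexivity; auto).
      apply (HZ _ _ _ H3) with (d := d) (e := e); auto.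
    + assert (H5 : opair e V ∈ F) by (eapply K; try reflexivity; auto).
      apply (HZ _ _ _ H1) with (d := d) (e := e); auto.
  - destruct (rel_separation (fun d q => exists F, opair (opair F d) q ∈ Z) R R)
      as [W [_ HW]]; [def|].
    assert (HW' : forall F d q, opair (opair F d) q ∈ Z -> opair d q ∈ W).
    { intros F d q H; apply HW; destruct (HZ _ _ _ H) as [_ [_ [Hd [_ [Hq _]]]]].
      split; [|split; [|eauto]]; [apply (lt_in _ _ Hd) | apply (lt_in _ _ Hq)]. }
    assert (SW : Sweep W).
    { split.
      - intros d q H; apply HW in H; destruct H as [_ [_ [F H]]]; apply HZ in H.
        split; [|split]; apply H.
      - intros d q H; apply HW in H; destruct H as [HdR [HqR [F H]]].
        destruct (HZS _ H) as [t [Ht Hstep]].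
        apply HSin in Hstep; destruct Hstep as [_ [_ [F1 [d1 [q1 [F2 [d2 [q2 K]]]]]]]].
        destruct K as [E1 [E2 [_ K]]].
        destruct (State_inj _ F d q _ _ _ eq_refl E1) as [<- [<- <-]].
        unfold State in E2; subst t; pose proof (HW' _ _ _ Ht) as HtW.
        destruct K as [[K ->]|[s [K1 [K2 [-> K3]]]]].
        + left; apply add_eq in K; auto; subst q2; auto.
        + right; apply add_eq in K1; auto; subst s; split; auto.
          exists d2; split; auto; symmetry; apply add_eq; auto;
            apply (lt_in zero d2), (HZ _ _ _ Ht). }
    intros a b Ha Hab Hb.
    destruct (sweep_dense W d0 q0 a b) as [d [q [Hdq Hlt]]]; eauto.
    apply HW in Hdq; destruct Hdq as [_ [_ [F HF]]].
    destruct (HZ _ _ _ HF) as [_ [_ [_ [_ [_ [U HU]]]]]]; eauto 6.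
Qed.

(** * The separating function *)

Section SeparatingFunction.

Variable G : M.
Hypothesis G_dense : DenseScale G.

(** The indices of the open sets that miss [x]; 0 makes it nonempty. *)
Definition Missed x d := d = zero \/ exists U, opair d U ∈ G /\ ~ x ∈ U.

Definition Value x s :=
  (forall d, d ∈ R -> Missed x d -> d ≼ s) /\
  forall u, u ∈ R -> (forall d, d ∈ R -> Missed x d -> d ≼ u) -> s ≼ u.

Lemma value_exists x : exists s, s ∈ R /\ Value x s.
Proof.
  destruct (separation (Missed x)) with (a := R) as [E HE]; [unfold Missed; def|].
  destruct (supremum E) as [s [HsR [Hs1 Hs2]]].
  - intros d Hd; apply HE, Hd.
  - exists zero; apply HE; split; auto; left; auto.
  - exists one; split; auto; intros d Hd; apply HE in Hd.
    destruct Hd as [_ [->|[U [HU _]]]]; auto.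
    apply (proj1 (proj2 (proj1 G_dense)) d U HU).
  - exists s; split; [auto|split].
    + intros d Hd Hm; apply Hs1, HE; auto.
    + intros u Hu H; apply Hs2; auto; intros d Hd; apply HE in Hd; apply H; tauto.
Qed.

Lemma value_unique x s t : s ∈ R -> t ∈ R -> Value x s -> Value x t -> s = t.
Proof. intros Hs Ht [H1 H2] [H3 H4]; apply le_antisym; auto. Qed.

Lemma value_bounds x s : Value x s -> zero ≼ s /\ s ≼ one.
Proof.
  intros [H1 H2]; split; [apply H1; auto; left; auto|].
  apply H2; auto; intros d Hd [->|[U [HU _]]]; auto.
  apply (proj1 (proj2 (proj1 G_dense)) d U HU).
Qed.

Lemma scale_in d U : opair d U ∈ G -> d ∈ R /\ U ∈ mu.
Proof. apply IsRel_in, G_dense. Qed.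

Lemma scale_mono d U e V : opair d U ∈ G -> opair e V ∈ G -> d ≺ e -> Subset U V.
Proof.
  intros HU HV Hde; apply Below_subset.
  - apply open_subset, (scale_in d U HU).
  - apply (proj1 (proj2 (proj2 (proj1 G_dense))) d U e V HU HV Hde).
Qed.

Lemma value_le x s d U : Value x s -> opair d U ∈ G -> x ∈ U -> s ≼ d.
Proof.
  intros [_ H] HU Hx; destruct (scale_in d U HU) as [Hd _].
  apply H; auto; intros e He [->|[V [HV Hn]]].
  - apply (proj1 (proj2 (proj1 G_dense)) d U HU).
  - destruct (le_or_lt e d) as [K|K]; auto.
    destruct Hn; apply (scale_mono d U e V HU HV K x Hx).
Qed.

Lemma le_value x s d U : Value x s -> opair d U ∈ G -> ~ x ∈ U -> d ≼ s.
Proof.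
  intros [H _] HU Hx; apply H; [apply (scale_in d U HU) | right; eauto].
Qed.

Hypothesis X_open : X ∈ mu.

(** For [a > 1] the neighbourhood is the whole space; otherwise it is a member
    of the scale. *)
Lemma value_lt_open a x s : a ∈ R -> x ∈ X -> Value x s -> s ≺ a ->
  exists O, O ∈ mu /\ x ∈ O /\
    forall y t, y ∈ O -> Value y t -> t ≺ a.
Proof.
  intros Ha Hx Hv Hsa.
  destruct (le_or_lt a one) as [K|K]; auto.
  - destruct (proj2 G_dense s a) as [d [U [HU [H1 H2]]]]; auto.
    { apply (value_bounds x s Hv). }
    exists U; split; [apply (scale_in d U HU)|]; split.
    + apply NNPP; intros N; apply (le_not_lt d s); auto; apply (le_value x s d U Hv HU N).
    + intros y t Hy Ht; apply le_lt_trans with d; auto; apply (value_le y t d U Ht HU Hy).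
  - exists X; split; [|split]; auto; intros y t _ Ht.
    apply le_lt_trans with one; auto; apply (value_bounds y t Ht).
Qed.

(** Here the closed sets between two members of the scale are used: their
    complements are neighbourhoods of the points with large value. *)
Lemma value_gt_open b x s : b ∈ R -> x ∈ X -> Value x s -> b ≺ s ->
  exists O, O ∈ mu /\ x ∈ O /\
    forall y t, y ∈ O -> Value y t -> b ≺ t.
Proof.
  intros Hb Hx Hv Hbs.
  destruct (le_or_lt zero b) as [K|K]; auto.
  - pose proof (proj2 (value_bounds x s Hv)) as Hs1.
    destruct (proj2 G_dense b s) as [d [U [HU [H1 H2]]]]; auto.
    destruct (proj2 G_dense b d) as [e [V [HV [H3 H4]]]]; auto.
    { left; eauto using lt_le_trans. }
    destruct (proj1 (proj2 (proj2 (proj1 G_dense))) e V d U HV HU H4) as [O [HO [K1 K2]]].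
    exists O; split; [|split]; auto.
    + destruct (K2 x Hx) as [N|]; auto.
      destruct (le_not_lt s d (value_le x s d U Hv HU N) H2).
    + intros y t Hy Ht; apply lt_le_trans with e; auto.
      apply (le_value y t e V Ht HV); intros N; apply K1; eauto.
  - exists X; split; [|split]; auto; intros y t _ Ht.
    apply lt_le_trans with zero; auto; apply (value_bounds y t Ht).
Qed.

Lemma value_function : exists f, IsFun f X R /\
  (forall nu, IsGtauN nu R lt -> Continuous f X mu nu) /\
  forall x s, opair x s ∈ f <-> x ∈ X /\ s ∈ R /\ Value x s.
Proof.
  destruct (rel_separation Value X R) as [f [Hrel Hf]].
  { unfold Value, Missed, Le, Lt; def. }
  exists f.
  assert (Htot : forall x, x ∈ X -> exists s, s ∈ R /\ opair x s ∈ f /\ Value x s).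
  { intros x Hx; destruct (value_exists x) as [s [Hs Hv]]; exists s.
    split; [|split]; auto; apply Hf; auto. }
  split; [split|split]; auto.
  - intros x Hx; destruct (Htot x Hx) as [s [Hs [Hxs Hv]]]; exists s; split; auto.
    intros t Ht; apply Hf in Ht; apply (value_unique x); tauto.
  - intros nu Hnu V HV P HP; apply open_local; [intros x Hx; apply HP, Hx|].
    intros x Hx; pose proof Hx as Hx'; apply HP in Hx'.
    destruct Hx' as [HxX [s [Hs Hxs]]]; pose proof Hxs as K.
    apply Hf in K; destruct K as [_ [HsR Hv]].
    assert (Hclose : forall O, O ∈ mu -> x ∈ O ->
      (forall y t, t ∈ R -> y ∈ O -> Value y t -> t ∈ V) ->
      exists O, O ∈ mu /\ x ∈ O /\ Subset O P).
    { intros O HO HxO H; exists O; split; [|split]; auto; intros y Hy.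
      pose proof (open_subset O HO y Hy) as HyX; destruct (Htot y HyX) as [t [Ht [Hyt Hvt]]].
      apply HP; eauto. }
    assert (Hleft : forall a, a ∈ R -> (forall t, t ∈ R -> t ≺ a -> t ∈ V) -> s ≺ a ->
      exists O, O ∈ mu /\ x ∈ O /\ Subset O P).
    { intros a Ha HaV Hsa; destruct (value_lt_open a x s) as [O [HO [HxO H]]]; auto.
      apply (Hclose O); eauto. }
    assert (Hright : forall b, b ∈ R -> (forall t, t ∈ R -> b ≺ t -> t ∈ V) -> b ≺ s ->
      exists O, O ∈ mu /\ x ∈ O /\ Subset O P).
    { intros b Hb HbV Hbs; destruct (value_gt_open b x s) as [O [HO [HxO H]]]; auto.
      apply (Hclose O); eauto. }
    apply Hnu in HV; destruct HV as [HV|[->|[[a [Ha HV]]|[[b [Hb HV]]|HV]]]].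
    + destruct (HV s Hs).
    + apply (Hclose X); auto.
    + apply (Hleft a); auto; [intros t Ht Hta; apply HV; auto | apply HV, Hs].
    + apply (Hright b); auto; [intros t Ht Hta; apply HV; auto | apply HV, Hs].
    + destruct HV as [a [Ha [b [Hb [_ HV]]]]].
      pose proof (proj2 (proj1 (HV s) Hs)) as [K|K].
      * apply (Hleft a); auto; intros t Ht Hta; apply HV; auto.
      * apply (Hright b); auto; intros t Ht Hta; apply HV; auto.
Qed.

End SeparatingFunction.

End Reals.

(** The whole space is open as soon as there are two disjoint closed sets: it is
    the union of their complements. *)
Theorem urysohn X mu :
  DependentChoice -> GenTopology X mu -> Normal X mu -> GeneralizedUrysohn X mu.
Proof.
  intros dc Hmu Hn R add mul lt zero one HR nu Hnu A B HA HB HAB.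
  destruct (Hn A B HA HB HAB) as [U0 [HU0 [O [HO [HUO [HAU HBO]]]]]].
  destruct (diff_exists X A) as [CA HCA], (diff_exists X B) as [U1 HU1].
  pose proof (proj2 HA CA HCA) as CAo; pose proof (proj2 HB U1 HU1) as U1o.
  assert (HX : X ∈ mu).
  { apply (open_local X mu Hmu); [intros x Hx; auto|]; intros x Hx.
    destruct (classic (x ∈ A)) as [K|K].
    - exists U1; split; [|split]; auto; [|apply Hmu; auto].
      apply HU1; split; auto; intros K'; apply HAB; eauto.
    - exists CA; split; [|split]; auto; [|apply Hmu; auto].
      apply HCA; auto. }
  assert (Hb : Below X mu U0 U1).
  { exists O; split; [|split]; auto; intros x Hx.
    destruct (classic (x ∈ B)) as [K|K]; [right; apply HBO, K | left; apply HU1; auto]. }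
  destruct (dense_scale_exists R add mul lt zero one HR X mu Hmu Hn U0 U1 HU0 U1o Hb dc)
    as [G HG].
  destruct (value_function R add mul lt zero one HR X mu Hmu U0 U1 G HG HX)
    as [f [Hf [Hc Hval]]].
  exists f; split; [|split; [|split]]; auto.
  - intros x Hx; destruct (IsFun_total _ _ _ x Hf (proj1 HA x Hx)) as [s [Hs Hxs]].
    replace zero with s; auto; apply Hval in Hxs; destruct Hxs as [_ [_ Hv]].
    apply (le_antisym R add mul lt zero one HR).
    + apply (value_le R add mul lt zero one HR X mu Hmu U0 U1 G HG x s zero U0 Hv); auto.
      apply HG.
    + apply (value_bounds R add mul lt zero one HR X mu U0 U1 G HG x s Hv).
  - intros x Hx; destruct (IsFun_total _ _ _ x Hf (proj1 HB x Hx)) as [s [Hs Hxs]].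
    replace one with s; auto; apply Hval in Hxs; destruct Hxs as [_ [_ Hv]].
    apply (le_antisym R add mul lt zero one HR).
    + apply (value_bounds R add mul lt zero one HR X mu U0 U1 G HG x s Hv).
    + apply (le_value R lt zero one X mu U0 U1 G HG x s one U1 Hv); [apply HG|].
      intros K; apply HU1 in K; tauto.
Qed.

End Model.

Lemma ZF_closed p : ZF p -> closed p.
Proof. intros []; cbn; try assumption; lia. Qed.

Theorem theorem3p2 :
  provable ZF
    ((DC ⇒ ∀ X mu, gen_topology X mu ⇒ normal X mu ⇒ GUL X mu)%fol 0).
Proof.
  apply completeness; [exact ZF_closed|].
  intros M mem HM r; apply (sat_theorem M mem (r 0) HM).
  intros dc X mu; apply (urysohn M mem (r 0) HM); exact dc.
Qed.
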